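(* Let the setting, the constant $M_0$ and the extended metric functions $m^*_{\mathrm N},m^*_{\mathrm C}$ be as in the context, and let $m^*$ be either $m^*_{\mathrm N}$ or $m^*_{\mathrm C}$. There exists $C\ge0$ such that for all $t\ge1$ and $y\in\mathbb{R}^n$ with $|y|\le M_0t$, $$m^*(2t,0,2y)\le2m^*(t,0,y)+C.$$
   Context: Let $n\ge2$ be an integer and let $\Omega\subset\mathbb{R}^n$ be an open connected set with nonempty $C^1$ boundary such that $\Omega+\mathbb{Z}^n=\Omega$; $\nu(y)$ is the outward unit normal at $y\in\partial\Omega$, $\Omega_\varepsilon:=\varepsilon\Omega$, $Y:=[-\frac12,\frac12]^n$. $H:\mathbb{R}^n\times\mathbb{R}^n\to\mathbb{R}$ is continuous, $\mathbb{Z}^n$-periodic in $y$, convex in $p$, and $\frac{|p|^2}{2}-K_0\le H(y,p)\le\frac{|p|^2}{2}+K_0$ for all $(y,p)$, for some $K_0>0$. $u_0:\mathbb{R}^n\to\mathbb{R}$ is bounded, uniformly continuous and Lipschitz. $\gamma:\partial\Omega\to\mathbb{R}^n$ is continuous, $\mathbb{Z}^n$-periodic, with $\gamma\cdot\nu>0$; $g\in C(\partial\Omega)$ is $\mathbb{Z}^n$-periodic (extended to $\mathbb{R}^n$); $\theta:\mathbb{R}^n\to[\frac{\pi}{2},\pi)$ is continuous, $\mathbb{Z}^n$-periodic, $h:=\cos\theta$. $L_{\mathrm N}(y,q,l):=\sup_{p}\{p\cdot q-H(y,p)\}-g(y)l$, $L_{\mathrm C}(y,q,l):=\sup_{p}\{p\cdot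 q-H(y,p)-h(y)l|p|\}$. Put $\beta_{\mathrm N}:=\gamma$, $\beta_{\mathrm C}:=\nu$. For $b\in\{\mathrm N,\mathrm C\}$, $\varepsilon>0$, $x\in\overline{\Omega}_\varepsilon$, $\mathrm{SP}^b_\varepsilon(x)$ is the set of $(\eta,v,l)\in\mathrm{AC}_{\rm loc}([0,\infty),\mathbb{R}^n)\times L^1_{\rm loc}([0,\infty),\mathbb{R}^n)\times L^1_{\rm loc}([0,\infty),\mathbb{R})$ with $\eta(0)=x$, $\eta(s)\in\overline{\Omega}_\varepsilon$ for all $s\ge0$, and for a.e. $s$: $\dot\eta(s)+l(s)\beta_b(\eta(s)/\varepsilon)=v(s)$, $l(s)\ge0$, and $l(s)=0$ if $\eta(s)\in\Omega_\varepsilon$ (then $l\beta_b$ is read as $0$). $\mathrm{SP}^b(x):=\mathrm{SP}^b_1(x)$. $V_b^\varepsilon(x,t):=\inf\{\int_0^tL_b(\frac{\eta}{\varepsilon},-v,-l)ds+u_0(\eta(t))\mid(\eta,v,l)\in\mathrm{SP}^b_\varepsilon(x)\}$. $M_0>0$ is a constant such that for all $\varepsilon>0$ and $(x,t)\in\overline{\Omega}_\varepsilon\times(0,\infty)$ the infimum $V_b^\varepsilon(x,t)$ is attained at some $(\eta,v,l)\in\mathrm{SP}^b_\varepsilon(x)$ with $\|\dot\eta\|_{L^\infty([0,t])}+\|l\|_{L^\infty([0,t])}\le M_0$ (such a constant is known to exist). Metric functions: for $x,y\in\overline{\Omega}$, $t\ge0$, $m_b(t,x,y):=\inf\{\int_0^tL_b(\eta(s),-v(s),-l(s))ds\mid(\eta,v,l)\in\mathrm{SP}^b(x),\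 \eta(t)=y\}$. Extended metric functions: for $x,y\in\mathbb{R}^n$, $t\ge0$, $m_b^*(t,x,y):=\inf\{m_b(t,\hat x,\hat y)\mid\hat x,\hat y\in\partial\Omega,\ \hat x-x\in Y,\ \hat y-y\in Y\}$. *)

(* Defs.v *)
From HB Require Import structures.
From mathcomp Require Import all_boot all_order all_algebra.
From mathcomp Require Import all_classical all_reals all_analysis.

Set Implicit Arguments.
Unset Strict Implicit.
Unset Printing Implicit Defensive.

Import Order.TTheory GRing.Theory Num.Theory.
Import numFieldNormedType.Exports.

Local Open Scope classical_set_scope.
Local Open Scope ring_scope.

Section euclidean.
Context {R : realType} {n : nat}.
Implicit Types (x y z : 'rV[R]_n) (A U : set 'rV[R]_n).

Definition dotp x y : R := \sum_(i < n) x 0 i * y 0 i.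

(* Not `|x|, which is the sup norm on 'rV[R]_n (with the same topology). *)
Definition enorm x : R := Num.sqrt (dotp x x).

Definition int_vec : set 'rV[R]_n := [set z | forall i, z 0 i \is a Num.int].

Definition unit_cube : set 'rV[R]_n :=
  [set x | forall i, - 2^-1 <= x 0 i <= 2^-1].

Definition periodic_on {T : Type} A (f : 'rV[R]_n -> T) :=
  forall x z, A x -> int_vec z -> f (x + z) = f x.

Definition boundary A : set 'rV[R]_n := closure A `\` interior A.

Definition dilate (eps : R) A : set 'rV[R]_n := [set eps *: x | x in A].

Definition grad (phi : 'rV[R]_n -> R) x : 'rV[R]_n :=
  \row_(i < n) 'D_(delta_mx 0 i) phi x.

Definition C1_on U (phi : 'rV[R]_n -> R) :=
  forall x, U x -> differentiable phi x /\ {for x, continuous (grad phi)}.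

Definition local_defining Om y U (phi : 'rV[R]_n -> R) :=
  [/\ open U, U y, C1_on U phi, (forall x, U x -> grad phi x != 0) &
      Om `&` U = [set x | phi x < 0] `&` U].

Definition C1_boundary Om :=
  forall y, boundary Om y -> exists U phi, local_defining Om y U phi.

Definition outward_unit_normal Om (nu : 'rV[R]_n -> 'rV[R]_n) :=
  forall y U phi, boundary Om y -> local_defining Om y U phi ->
    nu y = (enorm (grad phi y))^-1 *: grad phi y.

End euclidean.

Section curves.
Context {R : realType} {n : nat}.
Implicit Types (eta v : R -> 'rV[R]_n) (l : R -> R).
Local Notation mu := (@lebesgue_measure R).

Definition AC_on (T : R) eta := forall e : R, 0 < e -> exists2 d : R, 0 < d &
  forall (m : nat) (a b : 'I_m -> R),
    (forall i, 0 <= a i /\ a i <= b i /\ b i <= T) ->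
    trivIset setT (fun i => `]a i, b i[%classic) ->
    \sum_(i < m) (b i - a i) < d ->
    \sum_(i < m) enorm (eta (b i) - eta (a i)) < e.

(* Curves are total functions on R; only their restriction to [0, +oo[ is
   constrained. *)
Definition AC_loc eta := forall T : R, 0 <= T -> AC_on T eta.

Definition L1_loc l :=
  forall T : R, 0 <= T -> mu.-integrable `[0, T]%classic (EFin \o l).

Definition L1_loc_vec v := forall i : 'I_n, L1_loc (fun s => v s 0 i).

Definition Linfty_norm (t : R) l : \bar R :=
  Lnorm mu +oo%E ((EFin \o l) \_ `[0, t]%classic).

Definition SP (Om : set 'rV[R]_n) (beta : 'rV[R]_n -> 'rV[R]_n) (eps : R)
    (x : 'rV[R]_n) (eta v : R -> 'rV[R]_n) (l : R -> R) :=
  [/\ [/\ AC_loc eta, L1_loc_vec v & L1_loc l], eta 0 = x,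
      (forall s, 0 <= s -> closure (dilate eps Om) (eta s)) &
      {ae mu, forall s, 0 <= s ->
        [/\ derivable eta s 1,
            derive1 eta s + l s *: beta (eps^-1 *: eta s) = v s,
            0 <= l s &
            (dilate eps Om (eta s) -> l s = 0)]}].

Definition action (L : 'rV[R]_n -> 'rV[R]_n -> R -> R) (t : R)
    (eta v : R -> 'rV[R]_n) (l : R -> R) : \bar R :=
  (\int[mu]_(s in `[0%R, t]) (L (eta s) (- v s) (- l s))%:E)%E.

Definition value (Om : set 'rV[R]_n) beta L (u0 : 'rV[R]_n -> R)
    (eps : R) (x : 'rV[R]_n) (t : R) : \bar R :=
  ereal_inf [set c | exists eta v l, SP Om beta eps x eta v l /\
    c = (action L t (fun s => eps^-1 *: eta s) v l + (u0 (eta t))%:E)%E].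

Definition bounded_minimizers Om beta L u0 (M0 : R) :=
  forall (eps : R) (x : 'rV[R]_n) (t : R),
    0 < eps -> closure (dilate eps Om) x -> 0 < t ->
    exists eta v l, [/\ SP Om beta eps x eta v l,
      value Om beta L u0 eps x t =
        (action L t (fun s => eps^-1 *: eta s) v l + (u0 (eta t))%:E)%E &
      (Linfty_norm t (fun s => enorm (derive1 eta s)) + Linfty_norm t l
        <= M0%:E)%E].

Definition metric (Om : set 'rV[R]_n) beta L (t : R) (x y : 'rV[R]_n) : \bar R :=
  ereal_inf [set c | exists eta v l,
    [/\ SP Om beta 1 x eta v l, eta t = y & c = action L t eta v l]].

Definition ext_metric (Om : set 'rV[R]_n) beta L (t : R) (x y : 'rV[R]_n) :
    \bar R :=
  ereal_inf [set c | exists x' y', [/\ boundary Om x', boundary Om y',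
    unit_cube (x' - x), unit_cube (y' - y) & c = metric Om beta L t x' y']].

End curves.

Variant problem := Neumann | Capillary.

Section problems.
Context {R : realType} {n : nat}.
Implicit Types (y q p : 'rV[R]_n) (H : 'rV[R]_n -> 'rV[R]_n -> R).

(* Functions given on the boundary (nu, gamma, g) are total functions whose
   values off the boundary are unconstrained: they only ever occur multiplied by
   l, which vanishes at almost every time the curve is in the open set. *)
Definition direction (b : problem) (gamma nu : 'rV[R]_n -> 'rV[R]_n) :=
  match b with Neumann => gamma | Capillary => nu end.

(* The suprema below are over nonempty sets that are bounded above because H
   grows quadratically, so the real-valued sup is the true supremum. *)
Definition lagrangianN H (g : 'rV[R]_n -> R) y q (l : R) : R :=
  sup [set dotp p q - H y p | p in setT] - g y * l.

Definition lagrangianC H (h : 'rV[R]_n -> R) y q (l : R) : R :=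
  sup [set dotp p q - H y p - h y * l * enorm p | p in setT].

Definition lagrangian (b : problem) H g h :=
  match b with Neumann => lagrangianN H g | Capillary => lagrangianC H h end.

End problems.

(* Main.v *)
Require Import Defs.
From HB Require Import structures.
From mathcomp Require Import all_boot all_order all_algebra.
From mathcomp Require Import all_classical all_reals all_analysis.
From mathcomp Require Import measurable_realfun zify ring lra.

Set Implicit Arguments.
Unset Strict Implicit.
Unset Printing Implicit Defensive.

Import Order.TTheory GRing.Theory Num.Theory.
Import numFieldNormedType.Exports.

Local Open Scope classical_set_scope.
Local Open Scope ring_scope.

(* Subadditivity up to a constant by gluing a curve with an integer translate of
   itself.  Let eta be a competitor for m^*(t,0,y) with action a, running from
   x' to y', and let z be an integer vector with y' + z - 2y in Y.  Then
   y' and x' + z are boundary points at distance at most 3, so that they are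
   joined in the closure of Omega by a polygonal path whose number of edges
   and edge lengths are bounded uniformly (inward normal near the C^1 boundary,
   connectedness of Omega, compactness modulo Z^n).  Run eta, the path in time
   1, and eta + z; the missing unit of time is gained by running both copies of
   eta at speed k = t / (t - 1/2).

   The price of the speed-up is O(1).  Almost everywhere on a contact time the
   velocity of eta is tangential, whence l = O(|v|), and along eta
   c |v|^2 - C <= L <= |v|^2 + C.  Since k |-> L(y,-kv,-kl) is convex, the
   action increases by at most O(k - 1)(a + O(t)) = O(1), provided a = O(t).
   If a is not O(t), the polygonal paths themselves already give a competitor
   for m^*(2t,0,2y) of action at most 2a. *)

(** * Euclidean norm and integer vectors *)

(** Both problems are handled at once through two numbers: [rho], a lower bound of the reflection
    direction against the normal, and [kap], a bound of [|h|]. Since [l <= |v| / rho], the capillary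
    term takes away at most the fraction [kap / rho] of the speed, and [kap < rho] is what leaves
    the Lagrangian coercive. For the capillary problem [rho = 1], and the condition says that the
    contact angle stays away from [pi]. The main technical obstacle is integration. The running cost
    contains a supremum over all [p] and boundary data with arbitrary values off the boundary, so it
    need not be measurable as it stands, and the action can be infinite because [v] is only locally
    integrable. The argument therefore works with a nonnegative measurable function that equals the
    cost plus a constant almost everywhere, and with real cost budgets ([reach]), which simply add
    under gluing; the constant is subtracted again once, for the total time. Time has to be gained
    because the metric prescribes the elapsed time exactly. Each copy of the curve yields half a
    unit, and [t >= 1] keeps the speed [k] at most 2. *)

Section euclidean_norm.
Context {R : realType} {n : nat}.
Implicit Types (x y z : 'rV[R]_n) (a : R).

Lemma dotpC x y : dotp x y = dotp y x.
Proof. by apply: eq_bigr => i _; rewrite mulrC. Qed.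

Lemma dotpDl x y z : dotp (x + y) z = dotp x z + dotp y z.
Proof. by rewrite -big_split; apply: eq_bigr => i _; rewrite mxE mulrDl. Qed.

Lemma dotpZl a x y : dotp (a *: x) y = a * dotp x y.
Proof. by rewrite /dotp mulr_sumr; apply: eq_bigr => i _; rewrite mxE mulrA. Qed.

Lemma dotpNl x y : dotp (- x) y = - dotp x y.
Proof. by rewrite -scaleN1r dotpZl mulN1r. Qed.

Lemma dotpDr x y z : dotp x (y + z) = dotp x y + dotp x z.
Proof. by rewrite dotpC dotpDl !(dotpC x). Qed.

Lemma dotpZr a x y : dotp x (a *: y) = a * dotp x y.
Proof. by rewrite dotpC dotpZl dotpC. Qed.

Lemma dotpNr x y : dotp x (- y) = - dotp x y.
Proof. by rewrite dotpC dotpNl dotpC. Qed.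

Lemma dotp0 x : dotp 0 x = 0.
Proof. by rewrite -(scale0r 0) dotpZl mul0r. Qed.

Lemma dotpxx_ge0 x : 0 <= dotp x x.
Proof. by apply: sumr_ge0 => i _; rewrite -expr2 sqr_ge0. Qed.

Lemma sqr_enorm x : enorm x ^+ 2 = dotp x x.
Proof. by rewrite sqr_sqrtr // dotpxx_ge0. Qed.

Lemma enorm_ge0 x : 0 <= enorm x.
Proof. exact: sqrtr_ge0. Qed.

Lemma normr_coord_le_enorm x i : `|x 0 i| <= enorm x.
Proof.
rewrite -sqrtr_sqr ler_sqrt // ?dotpxx_ge0 // /dotp (bigD1 i) //= -expr2 lerDl.
by apply: sumr_ge0 => j _; rewrite -expr2 sqr_ge0.
Qed.

Lemma enorm0_eq0 x : enorm x = 0 -> x = 0.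
Proof.
move=> x0; apply/rowP => i; rewrite mxE; apply/normr0_eq0/eqP.
by rewrite eq_le normr_ge0 andbT -x0 normr_coord_le_enorm.
Qed.

Lemma enorm0 : enorm (0 : 'rV[R]_n) = 0.
Proof. by rewrite /enorm dotp0 sqrtr0. Qed.

Lemma enormZ a x : enorm (a *: x) = `|a| * enorm x.
Proof.
by rewrite /enorm dotpZl dotpZr mulrA -expr2 sqrtrM ?sqr_ge0 // sqrtr_sqr.
Qed.

Lemma enormN x : enorm (- x) = enorm x.
Proof. by rewrite -scaleN1r enormZ normrN1 mul1r. Qed.

Lemma dotp_le_enorm x y : dotp x y <= enorm x * enorm y.
Proof.
have [x0|x0] := eqVneq (enorm x) 0; first by rewrite (enorm0_eq0 x0) dotp0 enorm0 mul0r.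
have [y0|y0] := eqVneq (enorm y) 0.
  by rewrite (enorm0_eq0 y0) dotpC dotp0 enorm0 mulr0.
have xp : 0 < enorm x by rewrite lt0r x0 enorm_ge0.
have yp : 0 < enorm y by rewrite lt0r y0 enorm_ge0.
rewrite -(ler_pM2l (mulr_gt0 xp yp)).
have := dotpxx_ge0 (enorm y *: x - enorm x *: y).
rewrite dotpDl !dotpDr !dotpNl !dotpNr !dotpZl !dotpZr -!sqr_enorm (dotpC y x).
by set a := enorm x; set b := enorm y; set d := dotp x y => h; nra.
Qed.

Lemma normr_dotp_le x y : `|dotp x y| <= enorm x * enorm y.
Proof.
by rewrite ler_norml dotp_le_enorm andbT lerNl -dotpNl -[enorm x]enormN dotp_le_enorm.
Qed.

Lemma ler_enormD x y : enorm (x + y) <= enorm x + enorm y.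
Proof.
rewrite -ler_sqr ?nnegrE ?addr_ge0 ?enorm_ge0 // sqr_enorm dotpDl !dotpDr.
have := dotp_le_enorm x y.
by rewrite (dotpC y x) -!sqr_enorm => h; nra.
Qed.

Lemma norm_le_enorm x : `|x| <= enorm x.
Proof.
rewrite [X in X <= _]mx_normrE; apply/bigmax_leP; split=> [|[i j] _ /=].
  exact: enorm_ge0.
by rewrite ord1 normr_coord_le_enorm.
Qed.

Lemma normr_coord_le_norm x i : `|x 0 i| <= `|x|.
Proof.
rewrite [X in _ <= X]mx_normrE.
by rewrite (@le_bigmax _ _ _ 0 (fun ij : 'I_1 * 'I_n => `|x ij.1 ij.2|) (0, i)).
Qed.

Lemma norm_leP x (c : R) : 0 <= c -> (forall i, `|x 0 i| <= c) -> `|x| <= c.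
Proof.
move=> c0 xc; rewrite [X in X <= _]mx_normrE; apply/bigmax_leP.
by split=> [//|[i j] _ /=]; rewrite ord1.
Qed.

(** The crude factor [n.+1] is a positive number for every [n], so it can be divided by freely. *)
Lemma enorm_le_norm x : enorm x <= n.+1%:R * `|x|.
Proof.
rewrite -[leRHS]ger0_norm ?mulr_ge0 // -[leRHS]sqrtr_sqr ler_sqrt ?sqr_ge0 //.
apply: (@le_trans _ _ (\sum_(i < n) `|x| ^+ 2)).
  apply: ler_sum => i _; rewrite -expr2 -real_normK ?num_real //.
  by rewrite ler_sqr ?nnegrE // normr_coord_le_norm.
rewrite sumr_const card_ord exprMn -[leLHS]mulr_natl ler_wpM2r ?sqr_ge0 //.
by rewrite -natrX ler_nat; apply: (leq_trans (leqnSn _)); rewrite -mulnn leq_pmulr.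
Qed.

End euclidean_norm.

Section integer_vectors.
Context {R : realType} {n : nat}.
Implicit Types (x y z : 'rV[R]_n).

Lemma int_vecN z : int_vec z -> int_vec (- z).
Proof. by move=> zZ i; rewrite mxE rpredN. Qed.

Definition round_vec x : 'rV[R]_n := \row_i (Num.floor (x 0 i + 2^-1))%:~R.

Lemma int_vec_round x : int_vec (round_vec x).
Proof. by move=> i; rewrite mxE intr_int. Qed.

Lemma unit_cube_round x : unit_cube (round_vec x - x).
Proof.
move=> i; rewrite !mxE.
have := @floor_le R (x 0 i + 2^-1); have := @floorD1_gt R (x 0 i + 2^-1).
by rewrite intrD; lra.
Qed.

Lemma unit_cube_norm x : unit_cube x -> `|x| <= 2^-1.
Proof. by move=> xY; apply: norm_leP => // i; rewrite ler_norml xY. Qed.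

End integer_vectors.

(** * Absolutely continuous curves *)

Section absolute_continuity.
Context {R : realType} {n : nat}.
Implicit Types (eta : R -> 'rV[R]_n) (T k : R).

Lemma AC_on_eq T eta1 eta2 : (forall s, 0 <= s <= T -> eta1 s = eta2 s) ->
  AC_on T eta1 -> AC_on T eta2.
Proof.
move=> eq12 ac e e0; have [d d0 dP] := ac e e0; exists d => // m a b ab ti sd.
rewrite (eq_bigr (fun i => enorm (eta1 (b i) - eta1 (a i)))); first exact: dP.
by move=> i _; have [? [? ?]] := ab i; rewrite !eq12 //; lra.
Qed.

Lemma AC_onD T eta1 eta2 : AC_on T eta1 -> AC_on T eta2 ->
  AC_on T (fun s => eta1 s + eta2 s).
Proof.
move=> ac1 ac2 e e0; have e20 : 0 < e / 2 by lra.
have [d1 d10 dP1] := ac1 _ e20; have [d2 d20 dP2] := ac2 _ e20.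
exists (Num.min d1 d2) => [|m a b ab ti]; first by rewrite lt_min d10.
rewrite lt_min => /andP[sd1 sd2].
have h1 := dP1 m a b ab ti sd1; have h2 := dP2 m a b ab ti sd2.
rewrite [e]splitr; apply: le_lt_trans (ltrD h1 h2); rewrite -big_split; apply: ler_sum => i _ /=.
by apply: le_trans (ler_enormD _ _); rewrite opprD addrACA.
Qed.

Lemma AC_on_lipschitz T k eta : 0 <= k ->
  (forall s u, 0 <= s <= u -> enorm (eta u - eta s) <= k * (u - s)) -> AC_on T eta.
Proof.
move=> k0 lip e e0; have k1 : 0 < k + 1 by lra.
exists (e / (k + 1)) => [|m a b ab _]; first by rewrite divr_gt0.
rewrite ltr_pdivlMr // => sd; apply: le_lt_trans sd.
rewrite mulr_suml; apply: ler_sum => i _; have [? [? ?]] := ab i.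
apply: le_trans (lip _ _ _) _; first by apply/andP.
by nra.
Qed.

(** A nondecreasing Lipschitz reparametrisation sends disjoint intervals to disjoint intervals and
    multiplies the total length by at most [k]. Covers stopping, delaying and speeding up a
    curve. *)
Lemma AC_on_comp T T' k (r : R -> R) eta : 0 <= k ->
  (forall s, 0 <= s <= T' -> 0 <= r s <= T) ->
  (forall s u, 0 <= s -> s <= u -> u <= T' -> 0 <= r u - r s <= k * (u - s)) ->
  AC_on T eta -> AC_on T' (eta \o r).
Proof.
move=> k0 rT rk ac e e0; have [d d0 dP] := ac e e0; have k1 : 0 < k + 1 by lra.
exists (d / (k + 1)) => [|m a b ab ti]; first by rewrite divr_gt0.
rewrite ltr_pdivlMr // => sd; apply: (dP m (r \o a) (r \o b)) => [i /=||] /=.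
- have [a0 [aLb bT]] := ab i.
  have rai := rT (a i) (ltac:(lra)); have rbi := rT (b i) (ltac:(lra)).
  by have := rk (a i) (b i) a0 aLb bT; lra.
- apply/trivIsetP => i j _ _ ij; rewrite -subset0 => u [] /=.
  rewrite !in_itv /= => /andP[iu ui] /andP[ju uj].
  have [a0i [abi biT]] := ab i; have [a0j [abj bjT]] := ab j.
  have lti : a i < b i.
    by rewrite lt_neqAle abi andbT; apply/eqP => E; move: iu ui; rewrite E; lra.
  have ltj : a j < b j.
    by rewrite lt_neqAle abj andbT; apply/eqP => E; move: ju uj; rewrite E; lra.
  have aij : a j < b i.
    by rewrite ltNge; apply/negP => h; have := rk (b i) (a j); lra.
  have aji : a i < b j.
    by rewrite ltNge; apply/negP => h; have := rk (b j) (a i); lra.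
  move/trivIsetP: ti => /(_ i j I I ij); rewrite -subset0.
  (* If the images overlap, monotonicity of [r] makes the original intervals overlap; the point is
     the midpoint of their intersection. *)
  move=> /(_ ((Num.max (a i) (a j) + Num.min (b i) (b j)) / 2)); apply => /=.
  by rewrite !in_itv /=; case: (leP (a i) (a j)) => ?; case: (leP (b i) (b j)) => ?; split; apply/andP; split; lra.
- apply: le_lt_trans sd; rewrite mulr_suml; apply: ler_sum => i _.
  have [a0 [aLb bT]] := ab i; have := rk (a i) (b i) a0 aLb bT.
  by move=> /andP[? ?]; nra.
Qed.

Lemma AC_on_continuous T eta s e : AC_on T eta -> 0 <= s <= T -> 0 < e ->
  exists2 d : R, 0 < d &
    forall u, 0 <= u <= T -> `|u - s| < d -> enorm (eta u - eta s) < e.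
Proof.
move=> ac s0 e0; have [d d0 dP] := ac e e0; exists d => // u u0.
have aux a b : 0 <= a -> a <= b -> b <= T -> b - a < d -> enorm (eta b - eta a) < e.
  move=> a0 ab bT abd.
  have := dP 1 (fun=> a) (fun=> b); rewrite !big_ord1; apply=> //.
  by apply/trivIsetP => i j _ _; rewrite !ord1 eqxx.
rewrite ltr_norml => us; case: (leP s u) => su; first by apply: aux; lra.
by rewrite -enormN opprB; apply: aux; lra.
Qed.

(** Values at negative times are unconstrained, hence the curve is frozen at [eta 0] there. *)
Lemma AC_loc_continuous eta : AC_loc eta -> continuous (fun s : R => eta (Num.max s 0)).
Proof.
move=> ac s; apply/cvgrPdist_lt => e e0.
have s0 : 0 <= Num.max s 0 by rewrite le_max lexx orbT.
have T0 : 0 <= Num.max s 0 + 1 by lra.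
have sT : 0 <= Num.max s 0 <= Num.max s 0 + 1 by lra.
have [d d0 dP] := AC_on_continuous (ac _ T0) sT e0.
near=> u; rewrite distrC; apply: le_lt_trans (norm_le_enorm _) _.
have us : `|s - u| < Num.min d 1.
  by near: u; apply: cvgr_dist_lt; [exact: cvg_id|rewrite lt_min d0 ltr01].
move: us; rewrite lt_min !ltr_norml => /andP[us us1].
apply: dP; first by case: (leP u 0); case: (leP s 0); lra.
by rewrite ltr_norml; case: (leP u 0); case: (leP s 0); lra.
Unshelve. all: by end_near. Qed.

End absolute_continuity.

(** * Lebesgue measure and integration on the line *)

Section affine_change_of_variable.
Context {R : realType}.
Local Notation mu := (@lebesgue_measure R).
Variables (k b : R).
Hypothesis k0 : 0 < k.

Let phi : R -> measurableTypeR R := fun s => k * s + b.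

Lemma measurable_affine : measurable_fun [set: R] phi.
Proof. by apply: measurable_funD => //; apply: measurable_funM. Qed.

(** [k] times the pushforward of Lebesgue measure under the affine map gives every interval its
    length, so it is Lebesgue measure by uniqueness. *)
Lemma lebesgue_measure_affine (A : set R) : measurable A ->
  (k%:E * mu ((fun s : R => (k * s + b)%R) @^-1` A) = mu A)%E.
Proof.
move=> mA; have @nu : {measure set (measurableTypeR R) -> \bar R}.
  by apply: (mscale (NngNum (ltW k0)) (pushforward mu phi)); exact: measurable_affine.
suff : mu A = nu A by move=> ->.
apply: lebesgue_measure_unique => //= _ [[c d]] _ <-.
rewrite /nu /mscale /pushforward /= [X in (_ * mu X)%E](_ : _ = `](c - b) / k, (d - b) / k]%classic); last first.
  apply/seteqP; split=> s /=; rewrite /phi !in_itv /= ltr_pdivrMr // ler_pdivlMr //.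
    by move=> /andP[? ?]; apply/andP; split; lra.
  by move=> /andP[? ?]; apply/andP; split; lra.
rewrite !lebesgue_measure_itv /= !lte_fin ltr_pM2r ?invr_gt0 // ltrD2r.
case: ifP => _; last by rewrite mule0.
by rewrite -EFinM; congr EFin; field; rewrite gt_eqF.
Qed.

Lemma ge0_integral_affine (D : set R) (f : R -> \bar R) : measurable D ->
  measurable_fun D f -> (forall s, D s -> 0 <= f s)%E ->
  (k%:E * \int[mu]_(s in (fun s : R => (k * s + b)%R) @^-1` D) f (k * s + b)%R =
   \int[mu]_(s in D) f s)%E.
Proof.
move=> mD mf f0.
transitivity (k%:E * \int[pushforward mu phi]_(s in D) f s)%E.
  congr (_ * _)%E; apply/esym; apply: ge0_integral_pushforward => //.
    exact: measurable_affine.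
  by move=> y; rewrite inE; exact: f0.
have <- := @ge0_integral_mscale _ _ _ (pushforward mu phi) D mD (NngNum (ltW k0)) f mf f0.
  exact: measurable_affine.
move=> mphi; apply: eq_measure_integral => //= A mA AD; exact: lebesgue_measure_affine.
Qed.

Lemma ae_affine (P : R -> Prop) : {ae mu, forall s, P s} ->
  {ae mu, forall s, P (k * s + b)}.
Proof.
move=> [N [mN N0 PN]]; exists ((fun s => k * s + b) @^-1` N); split.
- by rewrite -[X in measurable X]setTI; apply: measurable_affine.
- have := lebesgue_measure_affine mN; rewrite N0 => /eqP.
  by rewrite mule_eq0 eqe gt_eqF //= => /eqP.
- by move=> s /= ns; apply: PN.
Qed.

End affine_change_of_variable.

Section eq_integral_ae.
Local Open Scope ereal_scope.
Context d (T : measurableType d) (R : realType).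
Variable mu : {measure set T -> \bar R}.
Import HBNNSimple.

Let nnint (f : T -> \bar R) :=
  ereal_sup [set sintegral mu h | h in [set h : {nnsfun T >-> R} |
    forall x, (h x)%:E <= f x]].

Let le_nnint_ae (f g : T -> \bar R) (N : set T) : measurable N -> mu N = 0 ->
  (forall x, 0 <= g x) -> (forall x, ~ N x -> f x = g x) -> nnint f <= nnint g.
Proof.
move=> mN N0 g0 fg; apply: le_ereal_sup => _ [h /= hf <-].
have mNC : measurable (~` N) by exact: measurableC.
pose k := mul_nnsfun h (indic_nnsfun R mNC).
exists k => [x|].
  rewrite [leLHS](_ : _ = (h x * \1_(~` N) x)%:E) // indicE; have [xN|xN] := boolP (x \in ~` N).
    by rewrite mulr1 -fg //; move: xN; rewrite inE.
  by rewrite mulr0.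
rewrite -!integralT_nnsfun; apply: ge0_ae_eq_integral => //.
- exact/measurable_EFinP.
- exact/measurable_EFinP.
- by move=> x _; rewrite lee_fin.
- by move=> x _; rewrite lee_fin.
exists N; split=> // x /=; apply: contra_notP => xN _.
by rewrite [RHS](_ : _ = (h x * \1_(~` N) x)%:E) // indicE mem_set // mulr1.
Qed.

(* Unlike [ae_eq_integral], no measurability is required: the integral of an
   arbitrary function is a difference of suprema over simple functions below it,
   and these may be cut off on a null set. *)
Lemma eq_integral_ae (D : set T) (f g : T -> \bar R) :
  {ae mu, forall x, D x -> f x = g x} ->
  \int[mu]_(x in D) f x = \int[mu]_(x in D) g x.
Proof.
move=> [N [mN N0 fgN]].
have fg x : ~ N x -> (f \_ D) x = (g \_ D) x.
  move=> Nx; rewrite /patch; case: ifPn => //; rewrite inE => Dx.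
  by apply: contrapT => nfg; apply: Nx; apply: fgN => /= /(_ Dx).
rewrite /integral -!/(nnint _); congr (_ - _); apply/eqP; rewrite eq_le;
  apply/andP; split; apply: (le_nnint_ae mN N0) => x; rewrite ?funepos_ge0 ?funeneg_ge0 //.
- by move=> Nx; rewrite !funeposE fg.
- by move=> Nx; rewrite !funeposE fg.
- by move=> Nx; rewrite !funenegE fg.
- by move=> Nx; rewrite !funenegE fg.
Qed.

End eq_integral_ae.

Section curve_derivative.
Context {R : realType} {n : nat}.
Implicit Types (eta : R -> 'rV[R]_n).

Lemma is_derive_affine eta (k b s : R) : derivable eta (k * s + b) 1 ->
  is_derive s 1 (fun u => eta (k * u + b)) (k *: derive1 eta (k * s + b)).
Proof.
move=> /derivable1_diffP de.
have dphi : is_derive s 1 (fun u : R => k * u + b) k.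
  have -> : (fun u : R => k * u + b) = (k \*: id + cst b) :> (R -> R) by apply/funext.
  by apply: is_derive_eq; rewrite addr0 [LHS]mulr1.
have dfphi : differentiable (fun u : R => k * u + b) s by apply/derivable1_diffP.
apply: DeriveDef; first exact/derivable1_diffP/differentiable_comp.
rewrite deriveE; last exact: differentiable_comp.
have d1 : 'd (fun u : R => k * u + b) s 1 = k by rewrite -deriveE // derive_val.
rewrite (diff_comp dfphi de) /= d1 derive1E deriveE // -linearZ.
by congr ('d eta _ _); rewrite [RHS]mulr1.
Qed.

Lemma is_derive_line (x w : 'rV[R]_n) (s : R) : is_derive s 1 (fun u : R => x + u *: w) w.
Proof.
have dq : h^-1 *: (((fun u : R => x + u *: w) \o shift s) (h *: (1 : R)) -
    (x + s *: w)) @[h --> (0 : R)^'] --> w.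
  apply: cvg_near_cst; near=> h.
  have h0 : h != 0 by near: h; exact: nbhs_dnbhs_neq.
  rewrite /= opprD addrACA subrr add0r -scalerBl addrK scalerA [_ *: (1 : R)]mulr1.
  by rewrite mulVf // scale1r.
apply: DeriveDef; first by apply/cvg_ex; exists w.
exact: cvg_lim dq.
Unshelve. all: by end_near. Qed.

End curve_derivative.

Definition concat {R : realType} {T : Type} (a : R) (f1 f2 : R -> T) (s : R) : T :=
  if s < a then f1 s else f2 (s - a).

Section local_integrability.
Context {R : realType}.
Local Notation mu := (@lebesgue_measure R).
Implicit Types (f : R -> R) (k b a : R).

Lemma integrable_affine k b (D : set R) f : 0 < k -> measurable D ->
  mu.-integrable D (EFin \o f) ->
  mu.-integrable ((fun s : R => k * s + b) @^-1` D) (EFin \o (fun s => f (k * s + b))).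
Proof.
move=> k0 mD /integrableP[mf foo].
have mphi := @measurable_affine R k b.
have mpD : measurable ((fun s : R => k * s + b) @^-1` D).
  by rewrite -[X in measurable X]setTI; exact: mphi.
apply/integrableP; split.
  apply: (measurable_comp mD _ mf) => //; first by move=> _ [s Ds <-].
  exact: measurable_funS mphi.
have mfa : measurable_fun D (fun s => `|(EFin \o f) s|%E).
  by apply: measurableT_comp => //; exact: abse_measurable.
have := ge0_integral_affine b k0 mD mfa (fun s _ => abse_ge0 _).
rewrite /= => E; move: foo; rewrite /= -E.
by case: (X in (k%:E * X)%E) => // [r|]; rewrite ?ltry // gt0_muley ?lte_fin.
Qed.

Lemma integrable_setU (A B : set R) (f : R -> \bar R) : measurable A -> measurable B ->
  [disjoint A & B] -> mu.-integrable A f -> mu.-integrable B f ->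
  mu.-integrable (A `|` B) f.
Proof.
move=> mA mB AB /integrableP[mfA fA] /integrableP[mfB fB].
have mf : measurable_fun (A `|` B) f by apply/measurable_funU.
apply/integrableP; split=> //; rewrite ge0_integral_setU //; first exact: lte_add_pinfty.
by apply: measurableT_comp => //; exact: abse_measurable.
Qed.

Lemma L1_loc_cst (c : R) : L1_loc (fun=> c).
Proof.
move=> T T0; apply: (@measurable_bounded_integrable _ _ _ mu (fun=> c)) => //.
  by rewrite /= lebesgue_measure_itv /=; case: ifP => _; rewrite ?ltry.
by exists `|c|; split; rewrite ?num_real // => M cM s _ /=; exact: ltW.
Qed.

Lemma L1_loc_scale k f : 0 < k -> L1_loc f -> L1_loc (fun s => k * f (k * s)).
Proof.
move=> k0 fL T T0; have kT : 0 <= k * T by rewrite mulr_ge0 // ltW.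
have := integrable_affine 0 k0 _ (fL _ kT).
rewrite (_ : _ @^-1` _ = `[0, T]%classic); last first.
  apply/seteqP; split=> s /=; rewrite addr0 !in_itv /= ler_pM2l // pmulr_rge0 //.
move=> /(_ (measurable_itv _)) fkL.
have : mu.-integrable `[0, T] (fun s => (k%:E * (EFin \o (fun s => f (k * s + 0)%R)) s)%E).
  exact: integrableZl.
by apply: eq_integrable => // s _ /=; rewrite addr0.
Qed.

Lemma L1_loc_concat a f1 f2 : 0 <= a -> L1_loc f1 -> L1_loc f2 ->
  L1_loc (concat a f1 f2).
Proof.
move=> a0 f1L f2L T T0.
have aT : mu.-integrable `[0, a + T]%classic (EFin \o concat a f1 f2).
  rewrite (_ : `[0, a + T]%classic = `[0, a[%classic `|` `[a, a + T]%classic); last first.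
    apply/seteqP; split=> s /=; rewrite !in_itv /=.
      by case: (ltP s a) => sa /andP[? ?]; [left|right]; apply/andP; split.
    by move=> [] /andP[? ?]; apply/andP; split; lra.
  apply: integrable_setU => //.
  - apply/disj_setPS => s [] /=; rewrite !in_itv /= => /andP[_ sa] /andP[? _].
    by move: sa; rewrite ltNge => /negP.
  - have : mu.-integrable `[0, a[%classic (EFin \o f1).
      by apply: integrableS (f1L _ a0) => //; apply: subset_itvl; rewrite bnd_simp.
    apply: eq_integrable => // s.
    by rewrite inE /= in_itv /= => /andP[_ sa]; rewrite /concat sa.
  - have := integrable_affine (- a) ltr01 _ (f2L _ T0).
    rewrite (_ : _ @^-1` _ = `[a, a + T]%classic); last first.
      by apply/seteqP; split=> s /=; rewrite mul1r !in_itv /= => /andP[? ?]; apply/andP; split; lra.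
    move=> /(_ (measurable_itv _)); apply: eq_integrable => // s.
    by rewrite inE /= in_itv /= mul1r /concat leNgt => /andP[/negbTE -> _].
by apply: integrableS aT => //; apply: subset_itvl; rewrite bnd_simp; lra.
Qed.

Lemma ae_mono (P Q : R -> Prop) : (forall s, P s -> Q s) ->
  {ae mu, forall s, P s} -> {ae mu, forall s, Q s}.
Proof. by move=> PQ; apply: filterS; first exact: (ae_filter_ringOfSetsType mu). Qed.

Lemma ae_and (P Q : R -> Prop) :
  {ae mu, forall s, P s} -> {ae mu, forall s, Q s} -> {ae mu, forall s, P s /\ Q s}.
Proof. by apply: filterI; exact: (ae_filter_ringOfSetsType mu). Qed.

Lemma ae_neq a : {ae mu, forall s, s <> a}.
Proof.
exists [set a]; split => //; first exact: lebesgue_measure_set1.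
by move=> s /= /contrapT.
Qed.

End local_integrability.

(** * Sweeping curves *)

Section sweeping_curves.
Context {R : realType} {n : nat}.
Local Notation mu := (@lebesgue_measure R).
Variables (Om : set 'rV[R]_n) (beta : 'rV[R]_n -> 'rV[R]_n).
Implicit Types (a k s T : R) (x y z w : 'rV[R]_n) (eta v : R -> 'rV[R]_n) (l : R -> R).

Definition sweeping_at eta v l (s : R) :=
  [/\ derivable eta s 1, derive1 eta s + l s *: beta (eta s) = v s, 0 <= l s &
      (Om (eta s) -> l s = 0)].

Lemma SPE x eta v l : SP Om beta 1 x eta v l <->
  [/\ [/\ AC_loc eta, L1_loc_vec v & L1_loc l], eta 0 = x,
      (forall s, 0 <= s -> closure Om (eta s)) &
      {ae mu, forall s, 0 <= s -> sweeping_at eta v l s}].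
Proof.
have dilate1 : dilate 1 Om = Om.
  apply/seteqP; split=> [_ [y Omy <-]|y Omy]; first by rewrite scale1r.
  by exists y => //; rewrite scale1r.
rewrite /SP dilate1 invr1; split=> -[? ? ? ae]; split=> //;
  by apply: ae_mono ae => s + s0 => /(_ s0); rewrite /sweeping_at scale1r.
Qed.

(** The condition is local in [eta], through its derivative, and pointwise in [v] and [l]. Away from
    a junction it passes from a piece to the glued curve. *)
Lemma near_sweeping_at eta1 v1 l1 eta2 v2 l2 s :
  (\near s, eta1 s = eta2 s) -> v1 s = v2 s -> l1 s = l2 s ->
  sweeping_at eta1 v1 l1 s -> sweeping_at eta2 v2 l2 s.
Proof.
move=> eq12 v12 l12 [d1 e1 l0 lz]; have e12 := nbhs_singleton eq12; split.
- exact: near_eq_derivable d1.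
- by rewrite -e12 -l12 -v12 -e1 !derive1E (near_eq_derive _ eq12).
- by rewrite -l12.
- by rewrite -e12 -l12.
Qed.

(** The sweeping equation is homogeneous of degree one in the velocity, [v] and [l]. One statement
    serves for time shifts ([k = 1]) and for speed-ups ([b = 0]). *)
Lemma sweeping_at_affine eta v l (k b s : R) : 0 <= k ->
  sweeping_at eta v l (k * s + b) ->
  sweeping_at (fun u => eta (k * u + b)) (fun u => k *: v (k * u + b))
    (fun u => k * l (k * u + b)) s.
Proof.
move=> k0 [de ev l0 lz]; have dk := is_derive_affine de.
split; [exact: dk.(ex_derive)| |by rewrite mulr_ge0|].
  by rewrite derive1E derive_val -ev scalerDr scalerA.
by move=> /lz ->; rewrite mulr0.
Qed.

Lemma SP_concat x y a eta1 v1 l1 eta2 v2 l2 : 0 <= a ->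
  SP Om beta 1 x eta1 v1 l1 -> eta1 a = y -> SP Om beta 1 y eta2 v2 l2 ->
  SP Om beta 1 x (concat a eta1 eta2) (concat a v1 v2) (concat a l1 l2).
Proof.
move=> a0 /SPE[[ac1 v1L l1L] e1x Om1 ae1] e1a /SPE[[ac2 v2L l2L] e2y Om2 ae2].
apply/SPE; split.
- split; last exact: L1_loc_concat.
    (* The glued curve is the sum of [eta1] stopped at time [a] and [eta2 - y] held at 0 until time
       [a]; both are reparametrisations with Lipschitz constant 1. *)
    move=> T T0; apply: (@AC_on_eq _ _ T
        (fun s : R => eta1 (Num.min s a) + (eta2 (Num.max (s - a) 0) + (- y)))).
      move=> s s0; rewrite /concat; case: (ltP s a) => sa.
        have -> : Num.max (s - a) 0 = 0 by rewrite max_r // subr_le0 ltW.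
        by rewrite e2y subrr addr0.
      have -> : Num.max (s - a) 0 = s - a by rewrite max_l // subr_ge0.
      by rewrite e1a addrC subrK.
    apply: AC_onD; last apply: AC_onD.
    + apply: (AC_on_comp (r := fun s : R => Num.min s a) ler01 _ _ (ac1 _ a0)).
        by move=> s s0 /=; case: (leP s a); lra.
      by move=> s u s0 su uT; case: (leP s a); case: (leP u a); lra.
    + apply: (AC_on_comp (r := fun s : R => Num.max (s - a) 0) ler01 _ _ (ac2 _ T0)).
        by move=> s s0 /=; case: (leP (s - a) 0); lra.
      by move=> s u s0 su uT; case: (leP (s - a) 0); case: (leP (u - a) 0); lra.
    + apply: (@AC_on_lipschitz _ _ _ 0) => // s u su.
      by rewrite subrr enorm0 mul0r.
  move=> i; have := L1_loc_concat a0 (v1L i) (v2L i); congr L1_loc.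
  by apply/funext => s; rewrite /concat; case: ifP.
- rewrite /concat; case: ltP => // a00; have -> : a = 0 by lra.
  by rewrite subrr e2y -e1a (_ : a = 0) //; lra.
- by move=> s s0; rewrite /concat; case: ltP => sa; [exact: Om1|apply: Om2; lra].
(* The junction time [a] is discarded as a null set, since the glued curve may have a corner
   there. *)
have := ae_affine (- a) ltr01 ae2.
move=> /(ae_and (ae_and ae1 (@ae_neq R a))); apply: ae_mono.
move=> s [[P1 sa] P2] s0; case: (ltP s a) => [lsa|las].
  apply: near_sweeping_at (P1 s0); rewrite /concat ?lsa //.
  by near=> u; rewrite ifT //; near: u; apply: lt_nbhsl.
have sa' : a < s by rewrite lt_neqAle las andbT; apply/eqP => /esym.
have := P2; rewrite mul1r subr_ge0 => /(_ las) => sw.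
have := @sweeping_at_affine eta2 v2 l2 1 (- a) s ler01; rewrite mul1r => /(_ sw).
apply: near_sweeping_at; rewrite /concat ?scale1r ?mul1r ?ltNge ?las //.
by near=> u; rewrite mul1r ifF //; apply/negbTE; rewrite -leNgt ltW //; near: u; apply: lt_nbhsr.
Unshelve. all: by end_near. Qed.

Lemma SP_speedup x k eta v l : 0 < k -> SP Om beta 1 x eta v l ->
  SP Om beta 1 x (fun s => eta (k * s)) (fun s => k *: v (k * s))
    (fun s => k * l (k * s)).
Proof.
move=> k0 /SPE[[ac vL lL] ex Ome ae]; apply/SPE; split.
- split; last exact: L1_loc_scale.
    move=> T T0; have kT0 : 0 <= k * T by rewrite mulr_ge0 // ltW.
    apply: (AC_on_comp (r := fun s : R => k * s) (ltW k0) _ _ (ac _ kT0)).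
      by move=> s /andP[s0 sT]; rewrite mulr_ge0 ?ler_pM2l // ltW.
    move=> s u s0 su uT; rewrite -mulrBr lexx andbT mulr_ge0 ?subr_ge0 //.
    exact: ltW.
  move=> i; have := L1_loc_scale k0 (vL i); congr L1_loc.
  by apply/funext => s; rewrite mxE.
- by rewrite mulr0.
- by move=> s s0; apply: Ome; rewrite mulr_ge0 // ltW.
have := ae_affine 0 k0 ae; apply: ae_mono => s + s0.
rewrite addr0 mulr_ge0 ?(ltW k0) // => /(_ isT) sw.
have := @sweeping_at_affine eta v l k 0 s (ltW k0); rewrite addr0 => /(_ sw).
by apply: near_sweeping_at; rewrite ?addr0 //; near=> u; rewrite addr0.
Unshelve. all: by end_near. Qed.

(** No reflection is spent even where the segment touches the boundary, as [l = 0] is always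
    allowed. The curve rests after time [T] because it must stay in the closed domain for all
    times. *)
Lemma SP_segment x w T : 0 <= T ->
  (forall s, 0 <= s <= T -> closure Om (x + s *: w)) ->
  SP Om beta 1 x (fun s : R => x + Num.min s T *: w) (concat T (fun=> w) (fun=> 0))
    (fun=> 0).
Proof.
move=> T0 seg; apply/SPE; split.
- split; last exact: L1_loc_cst.
    move=> S S0; apply: (@AC_on_lipschitz _ _ _ (enorm w)) => [|s u su].
      exact: enorm_ge0.
    rewrite opprD addrACA subrr add0r -scalerBl enormZ mulrC ler_wpM2l ?enorm_ge0 //.
    by rewrite ler_norml; case: (leP s T); case: (leP u T); lra.
  move=> i; have := L1_loc_concat T0 (L1_loc_cst (w 0 i)) (L1_loc_cst 0); congr L1_loc.
  by apply/funext => s; rewrite /concat; case: ifP; rewrite ?mxE.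
- by rewrite min_l // scale0r addr0.
- by move=> s s0; apply: seg; case: (leP s T); lra.
apply: ae_mono (@ae_neq R T) => s sT s0; case: (ltP s T) => [lsT|lTs].
  suff : sweeping_at (fun s => x + s *: w) (fun=> w) (fun=> 0) s.
    apply: near_sweeping_at; rewrite /concat ?lsT //.
    near=> u; rewrite min_l //; apply: ltW; near: u; exact: lt_nbhsl.
  have dw : is_derive s 1 (fun s : R => x + s *: w) w.
    exact: is_derive_line.
  split => //.
  by rewrite derive1E derive_val scale0r addr0.
have lTs' : T < s by rewrite lt_neqAle lTs andbT; apply/eqP => /esym.
suff : sweeping_at (fun=> x + T *: w) (fun=> 0) (fun=> 0) s.
  apply: near_sweeping_at; rewrite /concat ?ltNge ?lTs //.
  near=> u; rewrite min_r //; apply: ltW; near: u; exact: lt_nbhsr.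
split => //.
by rewrite derive1_cst scale0r addr0.
Unshelve. all: by end_near. Qed.

End sweeping_curves.

(** * Tangential velocity and periodicity of the domain *)

Section local_maximum.
Context {R : realType}.

(** At a local maximum the difference quotient is nonpositive for positive increments and
    nonnegative for negative ones, so its two-sided limit has no sign. *)
Lemma derive_local_max (f : R -> R) (s : R) : derivable f s 1 ->
  (\forall u \near s, f u <= f s) -> 'D_1 f s = 0.
Proof.
move=> df fmax; pose q h := h^-1 *: ((f \o shift s) (h *: (1 : R)) - f s).
have dq : q h @[h --> (0 : R)^'] --> 'D_1 f s by exact: df.
have key (P : R -> Prop) : (\forall h \near (0 : R)^', P (q h)) ->
    exists2 e : R, 0 < e & forall h, h != 0 -> `|h| < e ->
      P (h^-1 * (f (h + s) - f s)) /\ f (h + s) <= f s.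
  move=> [e1 /= e10 P1]; have [e2 /= e20 P2] := fmax.
  exists (Num.min e1 e2) => [|h h0]; first by rewrite lt_min e10.
  rewrite lt_min => /andP[h1 h2]; split.
    have := P1 h; rewrite /= sub0r normrN => /(_ h1 h0).
    by rewrite /q /= [_ *: (1 : R)]mulr1.
  by apply: P2; rewrite /= opprD addrCA subrr addr0 normrN.
apply/eqP; rewrite eq_le !leNgt; apply/andP; split; apply/negP => D0.
  have [e e0 P1] := key (fun u => 0 < u) (cvgr_gt _ dq _ D0).
  have e20 : 0 < e / 2 by lra.
  have eN0 : e / 2 != 0 by rewrite gt_eqF.
  have he : `|e / 2| < e by rewrite gtr0_norm //; lra.
  have [] := P1 _ eN0 he.
  by rewrite pmulr_rgt0 ?invr_gt0 // subr_gt0 => /lt_geF ->.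
have [e e0 P1] := key (fun u => u < 0) (cvgr_lt _ dq _ D0).
have e20 : - (e / 2) < 0 by lra.
have eN0 : - (e / 2) != 0 by rewrite lt_eqF.
have he : `|- (e / 2)| < e by rewrite ltr0_norm //; lra.
have [] := P1 _ eN0 he.
by rewrite nmulr_rlt0 ?invr_lt0 // subr_gt0 => /lt_geF ->.
Qed.

End local_maximum.

Section normed_closure.
Context {R : realType} {n : nat}.
Implicit Types (A : set 'rV[R]_n) (x y z w : 'rV[R]_n) (phi : 'rV[R]_n -> R).

Lemma closure_normP A x :
  closure A x <-> forall e : R, 0 < e -> exists2 y, A y & `|x - y| < e.
Proof.
split=> [cA e e0|cA B /nbhs_ballP[e /= e0 eB]].
  have [y [Ay xy]] := cA _ (nbhsx_ballx x e e0).
  by exists y => //; move: xy; rewrite -ball_normE.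
have [y Ay xy] := cA e e0; exists y; split => //.
by apply: eB; rewrite -ball_normE.
Qed.

Lemma boundaryE A x : open A -> boundary A x <-> closure A x /\ ~ A x.
Proof. by move=> oA; rewrite /boundary (interior_id A).1. Qed.

Lemma diff_grad phi x w : differentiable phi x -> 'd phi x w = dotp w (grad phi x).
Proof.
move=> dphi; rewrite {1}(row_sum_delta w) linear_sum /dotp; apply: eq_bigr => i _.
by rewrite linearZ /= mxE deriveE.
Qed.

(** Where [phi] is positive it is positive in a neighbourhood, which then misses the domain. *)
Lemma local_defining_le0 A y U phi x : local_defining A y U phi -> U x ->
  closure A x -> phi x <= 0.
Proof.
move=> [oU Uy c1 _ AU] Ux cA; rewrite leNgt; apply/negP => px.
have cphi : {for x, continuous phi} by apply: differentiable_continuous; exact: (c1 _ Ux).1.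
have nU : nbhs x [set u | U u /\ 0 < phi u].
  apply: filterI; first by apply: open_nbhs_nbhs; split.
  exact: (cvgr_gt _ cphi _ px).
have [u [Au [Uu pu]]] := cA _ nU.
have : (A `&` U) u by [].
by rewrite AU => -[/= ]; rewrite ltNge ltW.
Qed.

Lemma local_defining_boundary A y U phi x : open A -> local_defining A y U phi ->
  U x -> boundary A x -> phi x = 0.
Proof.
move=> oA ld Ux /(boundaryE _ oA)[cA nA]; apply/eqP; rewrite eq_le.
rewrite (local_defining_le0 ld Ux cA) /= leNgt; apply/negP => px.
apply: nA; have [_ _ _ _ AU] := ld.
by have [] : (A `&` U) x by rewrite AU.
Qed.

(* A curve in the closed domain touching the boundary maximizes the defining
   function there, so its velocity is tangential. *)
Lemma dotp_velocity_grad A (eta : R -> 'rV[R]_n) (s : R) U phi : open A -> 0 < s ->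
  (forall u, 0 <= u -> closure A (eta u)) -> derivable eta s 1 ->
  boundary A (eta s) -> local_defining A (eta s) U phi ->
  dotp (derive1 eta s) (grad phi (eta s)) = 0.
Proof.
move=> oA s0 cA /derivable1_diffP de bA ld; have [oU Uy c1 _ AU] := ld.
have dphi := (c1 _ Uy).1.
rewrite -diff_grad // derive1E deriveE //.
have dc : differentiable (phi \o eta) s by exact: differentiable_comp.
have := @derive_local_max R (phi \o eta) s; rewrite deriveE // diff_comp //=.
apply; first exact/derivable1_diffP.
rewrite (local_defining_boundary oA ld Uy bA).
have cs := differentiable_continuous de.
near=> u; apply: (local_defining_le0 ld).
  by near: u; apply: cs; apply: open_nbhs_nbhs; split.
by apply: cA; apply: ltW; near: u; exact: lt_nbhsr.
Unshelve. all: by end_near. Qed.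

End normed_closure.

Section periodic_domain.
Context {R : realType} {n : nat}.
Variable Om : set 'rV[R]_n.
Hypothesis Om_open : open Om.
Hypothesis Om_periodic : [set x + z | x in Om & z in int_vec] = Om.
Implicit Types (x y z : 'rV[R]_n).

Lemma Om_add x z : int_vec z -> Om x -> Om (x + z).
Proof. by move=> iz Ox; rewrite -Om_periodic; exists x => //; exists z. Qed.

Lemma Om_addE x z : int_vec z -> Om (x + z) <-> Om x.
Proof.
move=> iz; split=> [|]; last exact: Om_add.
by move=> /(Om_add (int_vecN iz)); rewrite addrK.
Qed.

Lemma closure_add x z : int_vec z -> closure Om x -> closure Om (x + z).
Proof.
move=> iz /closure_normP cx; apply/closure_normP => e /cx[y Oy xy].
by exists (y + z); [exact: Om_add|rewrite opprD addrACA subrr addr0].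
Qed.

Lemma boundary_add x z : int_vec z -> boundary Om x -> boundary Om (x + z).
Proof.
move=> iz /(boundaryE _ Om_open)[cx nx]; apply/boundaryE => //; split.
  exact: closure_add.
by move/(Om_addE _ iz).
Qed.

Lemma grad_translate phi x z : grad (fun y => phi (y - z)) x = grad phi (x - z).
Proof.
apply/rowP => i; rewrite !mxE /derive.
have E h : ((fun y => phi (y - z)) \o shift x) (h *: delta_mx 0 i) =
    (phi \o shift (x - z)) (h *: delta_mx 0 i) by rewrite /= addrA.
by under eq_fun do rewrite E.
Qed.

Lemma local_defining_translate y z U phi : int_vec z -> local_defining Om y U phi ->
  local_defining Om (y + z) [set x | U (x - z)] (fun x => phi (x - z)).
Proof.
move=> iz [oU Uy c1 g0 OU]; have cz : continuous (fun x : 'rV[R]_n => x - z).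
  by move=> x; apply: continuousB; [exact: cvg_id|exact: cst_continuous].
split.
- by apply: (@open_comp _ _ (fun x : 'rV[R]_n => x - z)) => // x _; exact: cz.
- by rewrite /= addrK.
- move=> x /= /c1[dphi cgrad]; split.
    apply: (@differentiable_comp _ _ _ _ (fun x => x - z) phi) => //.
  have -> : grad (fun y => phi (y - z)) = grad phi \o (fun x => x - z).
    by apply/funext => u; rewrite grad_translate.
  by apply: continuous_comp; [exact: cz|exact: cgrad].
- by move=> x /= Ux; rewrite grad_translate g0.
apply/seteqP; split=> x [/= Ox Ux]; split=> //.
  have : (Om `&` U) (x - z) by split=> //; apply/(Om_addE _ (int_vecN iz)).
  by rewrite OU => -[].
have : (Om `&` U) (x - z) by rewrite OU.
by move=> [/(Om_addE _ (int_vecN iz))].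
Qed.

(** A translated defining function defines the domain near the translated point and has the same
    gradient there; [nu] is determined by any defining function. *)
Lemma normal_periodic nu : C1_boundary Om -> outward_unit_normal Om nu ->
  periodic_on (boundary Om) nu.
Proof.
move=> c1 nuE y z by_ iz; have [U [phi ld]] := c1 y by_.
rewrite (nuE _ _ _ (boundary_add iz by_) (local_defining_translate iz ld)).
by rewrite grad_translate addrK (nuE _ _ _ by_ ld).
Qed.

Lemma SP_translate beta x z (eta v : R -> 'rV[R]_n) (l : R -> R) :
  periodic_on (boundary Om) beta -> int_vec z ->
  SP Om beta 1 x eta v l -> SP Om beta 1 (x + z) (fun s => eta s + z) v l.
Proof.
move=> betaP iz /SPE[[ac vL lL] ex Ome ae]; apply/SPE; split => //.
- split=> // T T0; apply: AC_onD; first exact: ac.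
  by apply: (@AC_on_lipschitz _ _ _ 0) => // s u su; rewrite subrr enorm0 mul0r.
- by rewrite ex.
- by move=> s s0; apply: closure_add => //; exact: Ome.
apply: ae_mono ae => s + s0 => /(_ s0) [de ev l0 lz].
have dz : is_derive s 1 (fun s => eta s + z) (derive1 eta s).
  have deta : is_derive s 1 eta (derive1 eta s) by rewrite derive1E; apply: derivableP.
  have := is_deriveD deta (is_derive_cst z s 1).
  by rewrite addr0.
split; [exact: dz.(ex_derive)| |exact: l0|].
  (* [beta] is periodic on the boundary only; in the open set [l] vanishes and [beta] drops out. *)
  rewrite derive1E derive_val; have [Oe|nOe] := pselect (Om (eta s)).
    by rewrite -ev lz // !scale0r.
  by rewrite betaP //; apply/boundaryE => //; split => //; exact: Ome.
by move/(Om_addE _ iz).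
Qed.

End periodic_domain.

(** * Polygonal paths in the closed domain *)

Lemma dotp_continuous {R : realType} {n : nat} (w : 'rV[R]_n) :
  continuous (fun x : 'rV[R]_n => dotp x w).
Proof.
move=> x A /nbhs_ballP[e /= e0 eA].
have k0 : 0 < n.+1%:R * (enorm w + 1) :> R by rewrite mulr_gt0 // ltr_wpDl ?enorm_ge0.
suff : nbhs x [set u | A (dotp u w)] by [].
apply/nbhs_ballP; exists (e / (n.+1%:R * (enorm w + 1))) => /=; first by rewrite divr_gt0.
move=> u; rewrite -ball_normE /= ltr_pdivlMr // => xu.
apply: eA; rewrite -ball_normE /= -dotpNl -dotpDl.
apply: le_lt_trans (normr_dotp_le _ _) _.
apply: le_lt_trans xu; rewrite mulrA [_ * n.+1%:R]mulrC.
by rewrite ler_pM ?enorm_ge0 ?enorm_le_norm // lerDl.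
Qed.

Section polygonal_paths.
Context {R : realType} {n : nat}.
Variable Om : set 'rV[R]_n.
Implicit Types (x y z w : 'rV[R]_n) (c : R).

Definition segment_in x y :=
  forall s : R, 0 <= s <= 1 -> closure Om (x + s *: (y - x)).

(** Polygonal path with [N] edges of sup-norm length at most [c]. Repeated vertices are allowed, so
    from a point of the closed domain [N] acts as an upper bound. *)
Fixpoint linked c (N : nat) x y : Prop :=
  if N is N'.+1 then
    exists z, [/\ segment_in x z, `|z - x| <= c & linked c N' z y]
  else x = y.

Lemma segment_in_sym x y : segment_in x y -> segment_in y x.
Proof.
move=> xy s s01; have s01' : 0 <= 1 - s <= 1 by lra.
rewrite (_ : y + _ = x + (1 - s) *: (y - x)); first exact: xy.
by apply/rowP => i; rewrite !mxE; ring.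
Qed.

Lemma segment_in_refl x : closure Om x -> segment_in x x.
Proof. by move=> cx s _; rewrite subrr scaler0 addr0. Qed.

Lemma linked_cat c N M x y z : linked c N x y -> linked c M y z ->
  linked c (N + M) x z.
Proof.
elim: N x => [|N IH] x /=; first by move=> ->.
by move=> [u [xu uc uy]] yz; exists u; split=> //; exact: IH.
Qed.

Lemma linked_sym c N x y : linked c N x y -> linked c N y x.
Proof.
elim: N x => [|N IH] x //= [z [xz zc /IH zy]]; rewrite -/(linked c N.+1 y x).
rewrite -addn1; apply: linked_cat zy _; exists x; split.
- exact: segment_in_sym.
- by rewrite distrC.
- by [].
Qed.

Lemma linked_le c c' N M x y : c <= c' -> 0 <= c' -> (N <= M)%N -> closure Om x ->
  linked c N x y -> linked c' M x y.
Proof.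
move=> cc' c0 NM cx xy; rewrite -(subnK NM); apply: (linked_cat (y := x)).
  elim: (M - N)%N => [//|k IH] /=; exists x; split => //; first exact: segment_in_refl.
  by rewrite subrr normr0.
elim: N x xy {cx NM} => [//|N IH] x /= [z [xz zc zy]]; exists z; split => //.
  exact: le_trans cc'.
exact: IH.
Qed.

(** One integer bounds both the number and the length of the edges. The relation is then monotone in
    a single parameter, which suits the compactness argument. *)
Definition chained (N : nat) x y := linked N%:R N x y.

Lemma chained_le N M x y : (N <= M)%N -> closure Om x -> chained N x y ->
  chained M x y.
Proof. by move=> NM; apply: linked_le => //; rewrite ?ler_nat. Qed.

Lemma chained_cat N M x y z : closure Om x -> closure Om y ->
  chained N x y -> chained M y z -> chained (N + M) x z.
Proof.
move=> cx cy xy yz; apply: (linked_cat (y := y)).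
  by apply: linked_le xy; rewrite ?ler_nat ?leq_addr.
by apply: linked_le yz; rewrite ?ler_nat ?leq_addl.
Qed.

Lemma chained_sym N x y : chained N x y -> chained N y x.
Proof. exact: linked_sym. Qed.

Lemma chained_segment x y : segment_in x y -> exists N, chained N x y.
Proof.
move=> xy; exists (Num.truncn `|y - x|).+1; have cx : closure Om x.
  by have := xy 0; rewrite scale0r addr0 lexx ler01; apply.
apply: (@linked_le (Num.truncn `|y - x|).+1%:R _ 1) => //.
by exists y; split => //; apply/ltW; rewrite truncnS_gt.
Qed.

Lemma segment_in_ball x y z (e : R) : ball x e `<=` Om -> ball x e y -> ball x e z ->
  segment_in y z.
Proof.
move=> xe; rewrite -ball_normE /= => xy xz s /andP[s0 s1]; apply: subset_closure.
apply: xe; rewrite -ball_normE /=.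
have -> : x - (y + s *: (z - y)) = (1 - s) *: (x - y) + s *: (x - z).
  by apply/rowP => i; rewrite !mxE; ring.
apply: le_lt_trans (ler_normD _ _) _; rewrite !normrZ (ger0_norm s0) ger0_norm; last lra.
have := normr_ge0 (x - y); have := normr_ge0 (x - z).
have [->|sN1] := eqVneq s 1; first by lra.
have : s < 1 by rewrite lt_neqAle sN1.
by nra.
Qed.

Hypothesis Om_open : open Om.

Lemma open_ball x : Om x -> exists2 e : R, 0 < e & ball x e `<=` Om.
Proof.
move=> Ox; have : nbhs x Om by apply: open_nbhs_nbhs.
by move=> /nbhs_ballP[e e0 xe]; exists e.
Qed.

(** The points of [Om] chained to [a] form a set that is open and closed in [Om], because a small
    ball is joined to its centre by segments. *)
Lemma chained_connected a b : connected Om -> Om a -> Om b -> exists N, chained N a b.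
Proof.
move=> cOm Oa Ob; pose B := [set u | Om u /\ exists N, chained N a u].
have ext u v e : ball u e `<=` Om -> 0 < e -> ball u e v -> B v -> B u.
  move=> ue e0 uv [Ov [N av]]; have Ou := ue _ (ballxx u e0); split => //.
  have [M vu] := chained_segment (segment_in_ball ue uv (ballxx u e0)).
  by exists (N + M)%N; apply: chained_cat av vu; exact: subset_closure.
have ext' u v e : ball u e `<=` Om -> 0 < e -> ball u e v -> B u -> B v.
  move=> ue e0 uv [Ou [N au]]; have Ov := ue _ uv; split => //.
  have [M vu] := chained_segment (segment_in_ball ue (ballxx u e0) uv).
  by exists (N + M)%N; apply: chained_cat au vu; exact: subset_closure.
have BE : B = Om.
  apply: cOm.
  - by exists a; split=> //; exists 0%N.
  - exists B; last by apply/seteqP; split=> u; [case=> Ou ?; split|case].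
    rewrite openE => u Bu; have [e e0 ue] := open_ball Bu.1.
    by apply/nbhs_ballP; exists e => [|v uv]; [exact: e0|exact: (ext' u v e)].
  - exists (closure B); first exact: closed_closure.
    apply/seteqP; split=> [u Bu|u [Ou cB]].
      by split; [exact: Bu.1|exact: subset_closure].
    have [e e0 ue] := open_ball Ou.
    have [v [Bv uv]] := cB _ (nbhsx_ballx u e e0); exact: (ext u v e).
by have [_ ?] : B b by rewrite BE.
Qed.

(** Take [w = - grad phi y]. Near [y] the gradient keeps a positive scalar product with
    [grad phi y], so [phi] decreases strictly along [w]; starting from [phi x <= 0] it becomes
    negative by the mean value theorem. *)
Lemma local_defining_inward y U phi : local_defining Om y U phi -> boundary Om y ->
  exists (w : 'rV[R]_n) (r : R), 0 < r /\ forall x s, closure Om x ->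
    `|x - y| < r -> 0 < s <= r -> Om (x + s *: w).
Proof.
move=> ld by_; have [oU Uy c1 g0 _] := ld.
pose g := grad phi y; have g_gt0 : 0 < dotp g g.
  rewrite lt_neqAle dotpxx_ge0 andbT; apply/eqP => /esym.
  rewrite -sqr_enorm => /eqP; rewrite sqrf_eq0 => /eqP /enorm0_eq0.
  exact/eqP/(g0 _ Uy).
have cdot : {for y, continuous ((fun x => dotp x g) \o grad phi)}.
  by apply: continuous_comp; [exact: (c1 _ Uy).2|exact: dotp_continuous].
have nU : nbhs y [set x | U x /\ 0 < dotp (grad phi x) g].
  apply: filterI; first by apply: open_nbhs_nbhs.
  exact: (cvgr_gt _ cdot _ g_gt0).
have /nbhs_ballP[e /= e0 ye] := nU.
(* Chosen so that a start within [r] of [y], followed by a displacement of at most [r |g|], stays in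
   the ball of radius [e]. *)
pose r := e / (2 * (1 + `|g|)).
have g1 : 0 < 1 + `|g| by rewrite ltr_pwDl.
have r0 : 0 < r by rewrite divr_gt0 // mulr_gt0.
have re : r * (1 + `|g|) = e / 2 by rewrite /r; field; lra.
exists (- g), r; split => // x s cx xy /andP[s0 sr].
have inU u : 0 <= u <= s -> U (x + u *: - g) /\ 0 < dotp (grad phi (x + u *: - g)) g.
  move=> /andP[u0 us]; apply: ye; rewrite -ball_normE /= opprD addrA scalerN opprK.
  apply: le_lt_trans (ler_normD _ _) _; rewrite distrC normrZ (ger0_norm u0).
  have := normr_ge0 g; nra.
have phidrv u : 0 <= u <= s -> is_derive u 1 (fun u : R => phi (x + u *: - g))
    (- dotp (grad phi (x + u *: - g)) g).
  move=> us; have [Uu _] := inU _ us; have [dphi _] := c1 _ Uu.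
  have dl := is_derive_line x (- g) u.
  have dld : differentiable (fun u : R => x + u *: - g) u by apply/derivable1_diffP.
  apply: DeriveDef; first by apply/derivable1_diffP; exact: differentiable_comp.
  rewrite deriveE; last exact: differentiable_comp.
  have d1 : 'd (fun u : R => x + u *: - g) u 1 = - g by rewrite -deriveE // derive_val.
  by rewrite (diff_comp dld dphi) /= d1 diff_grad // dotpNl dotpC.
have [||u us E] := @MVT R (fun u : R => phi (x + u *: - g))
    (fun u => - dotp (grad phi (x + u *: - g)) g) 0 s s0.
- by move=> u; rewrite in_itv /= => /andP[? ?]; apply: phidrv; lra.
- apply: derivable_within_continuous => u; rewrite in_itv /= => us.
  exact: (phidrv _ us).(ex_derive).
have [Us _] := inU s (ltac:(by rewrite lexx ltW)).
have [_ gu] := inU u (ltac:(by move: us; rewrite in_itv /=; lra)).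
have [U0 _] := inU 0 (ltac:(by rewrite lexx ltW)).
have phi0 : phi x <= 0.
  by apply: (local_defining_le0 ld) => //; move: U0; rewrite scale0r addr0.
have phis : phi (x + s *: - g) < 0.
  by move: E gu; rewrite scale0r addr0 subr0; nra.
have [_ _ _ _ OU] := ld; have [] // : (Om `&` U) (x + s *: - g).
by rewrite OU; split.
Qed.

Hypothesis Om_connected : connected Om.
Hypothesis Om_C1 : C1_boundary Om.

(** All nearby points of the closed domain are pushed inward by the same vector [r *: w] and land in
    one ball around [a] inside [Om]. Two edges suffice, with lengths bounded independently of the
    point. *)
Lemma chained_near_boundary y : boundary Om y -> exists2 a, Om a &
  exists (N : nat) (r : R), 0 < r /\ forall x, closure Om x -> `|x - y| < r -> chained N x a.
Proof.
move=> by_; have [U [phi ld]] := Om_C1 by_.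
have [w [r [r0 inOm]]] := local_defining_inward ld by_.
have cy : closure Om y by have /(boundaryE _ Om_open)[] := by_.
have Oa : Om (y + r *: w) by apply: inOm; rewrite ?subrr ?normr0 ?r0 ?lexx.
exists (y + r *: w) => //; have [e e0 ae] := open_ball Oa.
pose N1 := (Num.truncn (r * `|w|)).+1; pose N2 := (Num.truncn e).+1.
exists (N1 + N2 + 2)%N, (Num.min r e); split; first by rewrite lt_min r0.
move=> x cx; rewrite lt_min => /andP[xr xe].
have seg1 : segment_in x (x + r *: w).
  move=> s /andP[s0 s1]; rewrite addrAC subrr add0r scalerA.
  have [->|sn0] := eqVneq s 0; first by rewrite mul0r scale0r addr0.
  have sp : 0 < s by rewrite lt0r sn0.
  by apply: subset_closure; apply: inOm => //; rewrite mulr_gt0 // ger_pMl.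
have xw : ball (y + r *: w) e (x + r *: w).
  by rewrite -ball_normE /= opprD addrACA subrr addr0 distrC.
have seg2 := segment_in_ball ae xw (ballxx _ e0).
apply: (@linked_le (maxn N1 N2)%:R _ 2); rewrite ?ler_nat ?leq_addl //.
  by rewrite geq_max; apply/andP; split; lia.
exists (x + r *: w); split; first exact: seg1.
  rewrite addrAC subrr add0r normrZ gtr0_norm //.
  apply: (@le_trans _ _ N1%:R); first by apply/ltW; rewrite truncnS_gt.
  by rewrite ler_nat leq_maxl.
exists (y + r *: w); split; [exact: seg2| |by []].
apply: (@le_trans _ _ N2%:R); last by rewrite ler_nat leq_maxr.
have -> : y + r *: w - (x + r *: w) = y - x by rewrite opprD addrACA subrr addr0.
by rewrite distrC; apply/ltW; apply: lt_trans xe _; rewrite truncnS_gt.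
Qed.

Lemma closed_boundary : closed (boundary Om).
Proof.
have -> : boundary Om = closure Om `&` ~` Om.
  by apply/seteqP; split=> x /(boundaryE _ Om_open).
by apply: closedI; [exact: closed_closure|exact: open_closedC].
Qed.

Lemma compact_boundary_ball (M : R) : compact (boundary Om `&` [set x | `|x| <= M]).
Proof.
apply: bounded_closed_compact.
  by exists M; split; rewrite ?num_real // => M' MM' x [_ /= xM]; lra.
apply: closedI; first exact: closed_boundary.
rewrite (_ : [set x | _] = (fun x : 'rV[R]_n => `|x|) @^-1` [set u | u <= M]) //.
by apply: closed_comp => [x _|]; [exact: norm_continuous|exact: closed_le].
Qed.

Hypothesis Om_periodic : [set x + z | x in Om & z in int_vec] = Om.

Lemma linked_translate c N x y z : int_vec z -> linked c N x y ->
  linked c N (x + z) (y + z).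
Proof.
move=> iz; elim: N x => [|N IH] x /=; first by move=> ->.
move=> [u [xu uc uy]]; exists (u + z); split; last exact: IH.
  move=> s s01; rewrite opprD addrACA subrr addr0 addrAC.
  by apply: closure_add => //; exact: xu.
by rewrite opprD addrACA subrr addr0.
Qed.

(** Every boundary point of a fixed ball is chained to one interior point [a], with a common [N] by
    compactness; two points are joined through [a], hence [N + N]. *)
Lemma boundary_chained : boundary Om !=set0 -> exists N, forall x y,
  boundary Om x -> boundary Om y -> `|x - y| <= 3 -> chained N x y.
Proof.
move=> [y0 by0]; have [a Oa _] := chained_near_boundary by0.
have cb x : boundary Om x -> closure Om x by move=> /(boundaryE _ Om_open)[].
(* After an integer translation [x] has norm at most 1/2 and [y] at most 3 + 1/2, so radius 4
   contains both. *)
have /compact_near_coveringP := @compact_boundary_ball 4.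
move=> /(_ nat \oo (fun N x => boundary Om x -> chained N x a) _).
case.
  move=> y [by_ _]; have [c Oc [N [r [r0 yc]]]] := chained_near_boundary by_.
  have [M ca] := chained_connected Om_connected Oc Oa.
  exists (ball y r, [set k | (N + M <= k)%N]).
    by split; [exact: nbhsx_ballx|exists (N + M)%N].
  move=> [x k] [/= yx NMk] bx; apply: (chained_le NMk (cb _ bx)).
  apply: (chained_cat (cb _ bx) _ _ ca); first exact: subset_closure.
  by apply: yc; [exact: cb|move: yx; rewrite -ball_normE /= distrC].
move=> N _ /(_ N (leqnn N)) /= chN; exists (N + N)%N => x y bx by_ xy.
pose z := round_vec (- x); have iz : int_vec z := int_vec_round _.
have xz : `|x + z| <= 2^-1.
  by have /unit_cube_norm := @unit_cube_round _ _ (- x); rewrite opprK addrC.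
have bxz := boundary_add Om_open Om_periodic iz bx.
have byz := boundary_add Om_open Om_periodic iz by_.
have yz : `|y + z| <= 4.
  rewrite (_ : y + z = (x + z) - (x - y)); last by apply/rowP => i; rewrite !mxE; ring.
  by apply: le_trans (ler_normB _ _) _; lra.
have := chained_cat (cb _ bxz) (subset_closure Oa) (chN _ (conj bxz _) bxz)
  (chained_sym (chN _ (conj byz yz) byz)).
move=> /(_ ltac:(rewrite /=; lra)) /(linked_translate (int_vecN iz)).
by rewrite !addrK.
Qed.

End polygonal_paths.

(** * Growth of the Lagrangians *)

Section lagrangian_bounds.
Context {R : realType} {n : nat}.
Variables (Om : set 'rV[R]_n) (H : 'rV[R]_n -> 'rV[R]_n -> R).
Variables (g h : 'rV[R]_n -> R) (K0 kap rho G : R).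
Implicit Types (y q p v : 'rV[R]_n) (l lam : R).

(* Both Lagrangians are instances: [h = 0] for Neumann, [g = 0] for capillary. *)
Definition genL y q l : R :=
  sup [set dotp p q - H y p - h y * l * enorm p | p in setT] - g y * l.

(** What holds at almost every time along a sweeping curve, see [SP_admissible]; the estimates on
    the Lagrangian are valid for such triples. *)
Definition admissible y v l :=
  [/\ closure Om y, 0 <= l, (Om y -> l = 0) & l * rho <= enorm v].

(* Obtained by testing the supremum in [genL] with [p = - (1 - kap / rho) v] and
   bounding [l] by [enorm v / rho]. *)
Definition coercivity : R := (1 - kap / rho) ^+ 2 / 4.
Definition cost_shift : R := K0 + (G / (rho * (1 - kap / rho))) ^+ 2.

Hypothesis Om_open : open Om.
Hypothesis H_growth : forall y p,
  enorm p ^+ 2 / 2 - K0 <= H y p <= enorm p ^+ 2 / 2 + K0.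
Hypothesis K0_gt0 : 0 < K0.
Hypothesis kap_ge0 : 0 <= kap.
Hypothesis kap_lt_rho : kap < rho.
Hypothesis h_itv : forall y, - kap <= h y <= 0.
Hypothesis g_bound : forall y, boundary Om y -> `|g y| <= G.
Hypothesis G_ge0 : 0 <= G.

Let rho_gt0 : 0 < rho. Proof. exact: le_lt_trans kap_lt_rho. Qed.

Let mu_gt0 : 0 < 1 - kap / rho.
Proof. by rewrite subr_gt0 ltr_pdivrMr // mul1r. Qed.

Let mu_le1 : 1 - kap / rho <= 1.
Proof. by rewrite gerBl divr_ge0 // ltW. Qed.

Lemma coercivity_gt0 : 0 < coercivity.
Proof. by rewrite divr_gt0 // exprn_gt0. Qed.

Lemma cost_shift_ge0 : 0 <= cost_shift.
Proof. by rewrite addr_ge0 ?sqr_ge0 // ltW. Qed.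

(** With [h <= 0] and [l >= 0] the capillary term only lowers the value; the rest is the Legendre
    transform of a quadratic. *)
Lemma genL_ub y v l p : 0 <= l ->
  dotp p (- v) - H y p - h y * - l * enorm p <= enorm v ^+ 2 / 2 + K0.
Proof.
move=> l0; have /andP[Hp _] := H_growth y p; have /andP[_ h0] := h_itv y.
have := dotp_le_enorm p (- v); rewrite enormN.
have hl : 0 <= h y * - l * enorm p.
  by rewrite mulrN -mulNr mulr_ge0 ?enorm_ge0 // mulr_ge0 // oppr_ge0.
move: hl Hp; set d := dotp _ _; set t := _ * enorm p; set a := enorm p; set b := enorm v.
by move=> *; have := sqr_ge0 (a - b); rewrite !expr2; nra.
Qed.

Lemma genL_has_sup y v l : 0 <= l ->
  has_sup [set dotp p (- v) - H y p - h y * - l * enorm p | p in setT].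
Proof.
move=> l0; split; first by exists (dotp 0 (- v) - H y 0 - h y * - l * enorm (0 : 'rV[R]_n)), 0.
by exists (enorm v ^+ 2 / 2 + K0) => _ [p _ <-]; exact: genL_ub.
Qed.

Lemma genL_lb y v l p : 0 <= l ->
  dotp p (- v) - H y p - h y * - l * enorm p <=
    sup [set dotp p (- v) - H y p - h y * - l * enorm p | p in setT].
Proof.
by move=> l0; apply: sup_ubound; [exact: (genL_has_sup y v l0).2|exists p].
Qed.

Lemma admissible_g y v l : admissible y v l -> `|g y * l| <= G / rho * enorm v.
Proof.
move=> [cy l0 lz lrho]; have v0 := enorm_ge0 v.
have Gr : 0 <= G / rho by rewrite divr_ge0 // ltW.
have [Oy|nOy] := pselect (Om y); first by rewrite lz // mulr0 normr0 mulr_ge0.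
rewrite normrM (ger0_norm l0) -mulrA ler_pM //.
  by apply: g_bound; apply/boundaryE.
by rewrite mulrC ler_pdivlMr.
Qed.

Lemma genL_ge y v l : admissible y v l ->
  coercivity * enorm v ^+ 2 <= genL y (- v) (- l) + cost_shift.
Proof.
move=> ad; have [cy l0 lz lrho] := ad.
have := admissible_g ad; rewrite ler_norml => /andP[gl _].
(* Testing with [- s v] gives at least [(s (1 - kap / rho) - s^2 / 2) |v|^2 - K0], up to the [g]
   term; the factor [s = 1 - kap / rho] maximises this. *)
have := genL_lb y v (- (1 - kap / rho) *: v) l0.
rewrite dotpZl dotpNr -sqr_enorm enormZ normrN gtr0_norm //.
have /andP[_ HK] := H_growth y (- (1 - kap / rho) *: v).
move: HK; rewrite enormZ normrN gtr0_norm //.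
have /andP[hk h0] := h_itv y.
have hl : - h y * l * enorm v <= kap / rho * enorm v * enorm v.
  rewrite ler_wpM2r ?enorm_ge0 // mulrAC ler_pdivlMr // -mulrA.
  by rewrite ler_pM ?mulr_ge0 // ?oppr_ge0 ?(ltW rho_gt0) // lerNl.
rewrite /genL /coercivity /cost_shift; set S := sup _.
have -> : G / (rho * (1 - kap / rho)) = (G / rho) / (1 - kap / rho).
  by field; rewrite !gt_eqF // subr_gt0.
move: gl hl mu_gt0; set m := kap / rho; set c := G / rho; set a := enorm v.
set Hp := H y _; move=> gl hl m0 HK HS.
(* Young's inequality: half of the quadratic gain [(1 - m)^2 a^2 / 2] absorbs the boundary cost
   [c a], at the price of the square in [cost_shift]. *)
have := sqr_ge0 ((1 - m) * a / 2 - c / (1 - m)).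
have E : c / (1 - m) * (1 - m) = c by rewrite divfK // gt_eqF.
move: E; set e := c / (1 - m); move=> E.
have hl' : (1 - m) * (- h y * l * a) <= (1 - m) * (m * a * a) by rewrite ler_pM2l.
by rewrite !expr2 => sq; move: HK HS; rewrite !expr2 => HK HS; nra.
Qed.

Lemma genL_le y v l : admissible y v l ->
  genL y (- v) (- l) <= enorm v ^+ 2 + cost_shift.
Proof.
move=> ad; have [cy l0 lz lrho] := ad.
have := admissible_g ad; rewrite ler_norml => /andP[_ gl].
have : sup [set dotp p (- v) - H y p - h y * - l * enorm p | p in setT] <=
    enorm v ^+ 2 / 2 + K0.
  apply: ge_sup; first exact: (genL_has_sup y v l0).1.
  by move=> _ [p _ <-]; exact: genL_ub.
rewrite /genL /cost_shift; set S := sup _ => SK.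
have : (G / rho) ^+ 2 <= (G / (rho * (1 - kap / rho))) ^+ 2.
  rewrite ler_sqr ?nnegrE ?divr_ge0 ?mulr_ge0 ?(ltW rho_gt0) ?(ltW mu_gt0) //.
  rewrite ler_wpM2l // lef_pV2 ?posrE ?mulr_gt0 //.
  by rewrite ger_pMr.
have := sqr_ge0 (enorm v - G / rho); move: gl SK.
by rewrite !expr2; nra.
Qed.

(** For each fixed [p] the expression is affine in the speed factor, and
    [lam = (2 - lam) * 1 + (lam - 1) * 2]. *)
Lemma genL_convex y v l lam : 0 <= l -> 1 <= lam <= 2 ->
  genL y (- (lam *: v)) (- (lam * l)) <=
  (2 - lam) * genL y (- v) (- l) + (lam - 1) * genL y (- (2 *: v)) (- (2 * l)).
Proof.
move=> l0 lam12; have laml : 0 <= lam * l by rewrite mulr_ge0 //; lra.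
have l2 : 0 <= 2 * l by rewrite mulr_ge0.
rewrite /genL; set S := sup _; set S1 := sup _; set S2 := sup _.
suff : S <= (2 - lam) * S1 + (lam - 1) * S2 by lra.
apply: ge_sup; first exact: (genL_has_sup y (lam *: v) laml).1.
move=> _ [p _ <-]; have := genL_lb y v p l0; have := genL_lb y (2 *: v) p l2.
rewrite -/S1 -/S2 !dotpNr !dotpZr.
set d := dotp p v; set e := h y; set a := enorm p => h1 h2.
have {}h1 : (lam - 1) * (- (2 * d) - H y p - e * - (2 * l) * a) <= (lam - 1) * S2.
  by rewrite ler_wpM2l //; lra.
have {}h2 : (2 - lam) * (- d - H y p - e * - l * a) <= (2 - lam) * S1.
  by rewrite ler_wpM2l //; lra.
by apply: le_trans (lerD h2 h1); rewrite le_eqVlt; apply/orP; left; apply/eqP; ring.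
Qed.

Lemma admissibleZ y v l lam : 0 <= lam -> admissible y v l ->
  admissible y (lam *: v) (lam * l).
Proof.
move=> lam0 [cy l0 lz lr]; split => //; first by rewrite mulr_ge0.
  by move=> /lz ->; rewrite mulr0.
by rewrite enormZ ger0_norm // -mulrA ler_wpM2l.
Qed.

(** By convexity it suffices to control doubled speed, where the cost is at most [4 |v|^2] plus a
    constant, and coercivity bounds [|v|^2] by the shifted cost divided by [coercivity]. Hence
    [4 / coercivity]. *)
Lemma genL_speedup y v l lam : 1 <= lam <= 2 -> admissible y v l ->
  genL y (- (lam *: v)) (- (lam * l)) + cost_shift <=
  (1 + (lam - 1) * (4 / coercivity)) * (genL y (- v) (- l) + cost_shift) +
  (lam - 1) * (2 * cost_shift).
Proof.
move=> lam12 ad; have [_ l0 _ _] := ad.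
have lo := genL_ge ad; have c0 := coercivity_gt0.
have := genL_le (admissibleZ (ler0n R 2) ad).
rewrite enormZ ger0_norm // => up.
have := genL_convex y v l0 lam12.
have {}lo : enorm v ^+ 2 <= (genL y (- v) (- l) + cost_shift) / coercivity.
  by rewrite ler_pdivlMr // mulrC.
have sq0 := sqr_ge0 (enorm v).
have Lt0 : 0 <= genL y (- v) (- l) + cost_shift.
  by rewrite -[leRHS](divfK (lt0r_neq0 c0)) mulr_ge0 ?(ltW c0) //; exact: le_trans lo.
move: lo up; rewrite exprMn (_ : 2 ^+ 2 = 4 :> R); last by ring.
set L1 := genL y (- v) _ in Lt0 *; set L2 := genL _ _ _; set La := genL _ _ _.
set w := enorm v ^+ 2; set X := (L1 + _) / _.
move=> lo up cv.
have : (lam - 1) * (L2 + cost_shift) <= (lam - 1) * (4 * X + 2 * cost_shift).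
  by rewrite ler_wpM2l //; lra.
have : 0 <= (lam - 1) * (L1 + cost_shift) by rewrite mulr_ge0 //; lra.
have -> : (1 + (lam - 1) * (4 / coercivity)) * (L1 + cost_shift) =
    (L1 + cost_shift) + (lam - 1) * (4 * X) by rewrite /X; ring.
by move: cv; lra.
Qed.

End lagrangian_bounds.

(** * Constants uniform over the periodic boundary *)

Section uniform_constants.
Context {R : realType} {n : nat}.
Variables (Om : set 'rV[R]_n) (nu : 'rV[R]_n -> 'rV[R]_n).
Hypothesis Om_open : open Om.
Hypothesis Om_periodic : [set x + z | x in Om & z in int_vec] = Om.
Hypothesis Om_C1 : C1_boundary Om.
Hypothesis nu_normal : outward_unit_normal Om nu.
Implicit Types (x y z : 'rV[R]_n).

(** Compactness modulo integer vectors: the boundary points of norm at most 1 represent all classes,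
    and bounds valid near each of them for all large [N] have a common [N]. *)
Lemma boundary_uniform (P : nat -> 'rV[R]_n -> Prop) :
  (forall N x z, boundary Om x -> int_vec z -> P N (x + z) -> P N x) ->
  (forall y, boundary Om y -> exists (N : nat) (r : R), 0 < r /\
    forall x M, boundary Om x -> `|x - y| < r -> (N <= M)%N -> P M x) ->
  exists N, forall x, boundary Om x -> P N x.
Proof.
move=> Pper Ploc; have /compact_near_coveringP := @compact_boundary_ball _ _ _ Om_open 1.
move=> /(_ nat \oo (fun N x => boundary Om x -> P N x) _).
case.
  move=> y [by_ _]; have [N [r [r0 yr]]] := Ploc _ by_.
  exists (ball y r, [set k | (N <= k)%N]).
    by split; [exact: nbhsx_ballx|exists N].
  move=> [x k] [/= yx Nk] bx; apply: yr => //.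
  by move: yx; rewrite -ball_normE /= distrC.
move=> N _ /(_ N (leqnn N)) /= PN; exists N => x bx.
have iz := @int_vec_round _ _ (- x); have bxz := boundary_add Om_open Om_periodic iz bx.
apply: (Pper _ _ _ bx iz); apply: PN => //; split=> //.
have /unit_cube_norm := @unit_cube_round _ _ (- x); rewrite opprK addrC /=; lra.
Qed.

Lemma within_continuous_near {V : normedModType R} (A : set 'rV[R]_n) (f : 'rV[R]_n -> V) y (e : R) :
  {within A, continuous f} -> A y -> 0 < e ->
  exists2 r : R, 0 < r & forall x, A x -> `|x - y| < r -> `|f x - f y| < e.
Proof.
move=> /subspace_continuousP cf Ay e0; have := cf y Ay _ (nbhsx_ballx (f y) e e0).
move=> /nbhs_ballP[r /= r0 yr]; exists r => // x Ax xy.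
have := yr x; rewrite -ball_normE /= distrC => /(_ xy Ax).
by rewrite -ball_normE /= distrC.
Qed.

Lemma boundary_bounded (f : 'rV[R]_n -> R) : {within boundary Om, continuous f} ->
  periodic_on (boundary Om) f -> exists2 G : R, 0 <= G & forall y, boundary Om y -> `|f y| <= G.
Proof.
move=> cf pf; have [||N fN] := boundary_uniform (P := fun N x => `|f x| <= N%:R).
- by move=> N x z bx iz; rewrite pf.
- move=> y by_; have [r r0 yr] := within_continuous_near cf by_ ltr01.
  exists (Num.truncn (`|f y| + 1)).+1, r; split=> // x M bx xy NM.
  apply: (@le_trans _ _ (Num.truncn (`|f y| + 1)).+1%:R); last by rewrite ler_nat.
  apply/ltW/(le_lt_trans _ (truncnS_gt _)).
  have := ler_normD (f x - f y) (f y); rewrite subrK.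
  by have := yr x bx xy; lra.
by exists N%:R.
Qed.

Lemma enorm_normal y : boundary Om y -> enorm (nu y) = 1.
Proof.
move=> by_; have [U [phi ld]] := Om_C1 by_; rewrite (nu_normal by_ ld) enormZ.
have [_ Uy _ g0 _] := ld; rewrite ger0_norm ?invr_ge0 ?enorm_ge0 // mulVf //.
by apply/eqP => /enorm0_eq0 /eqP; apply/negP; exact: g0.
Qed.

(** Near a boundary point [nu] is the normalised gradient of a single defining function, which
    supplies the continuity. The bound is sought as [N.+1^-1], which weakens as [N] grows. *)
Lemma oblique_bound (gamma : 'rV[R]_n -> 'rV[R]_n) :
  {within boundary Om, continuous gamma} -> periodic_on (boundary Om) gamma ->
  (forall y, boundary Om y -> 0 < dotp (gamma y) (nu y)) ->
  exists2 rho : R, 0 < rho & forall y, boundary Om y -> rho <= dotp (gamma y) (nu y).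
Proof.
move=> cg pg gnu.
have [||N rN] := boundary_uniform (P := fun N x => N.+1%:R^-1 <= dotp (gamma x) (nu x)).
- by move=> N x z bx iz; rewrite pg // (normal_periodic Om_open Om_periodic Om_C1 nu_normal).
- move=> y by_; have [U [phi ld]] := Om_C1 by_; have [oU Uy c1 g0 _] := ld.
  set a := gamma y; set b := grad phi y; pose D := dotp a b.
  have b0 : 0 < enorm b.
    by rewrite lt0r enorm_ge0 andbT; apply/eqP => /enorm0_eq0/eqP; apply/negP; exact: g0.
  have D0 : 0 < D.
    have := gnu _ by_; rewrite (nu_normal by_ ld) dotpZr -/a -/b -/D.
    by rewrite pmulr_rgt0 // invr_gt0.
  have a0 := enorm_ge0 a.
  (* If both vectors move by at most [e], their scalar product drops by at most
     [e |a| + e |b| + e^2 <= D / 2]. The division of [e] by [n.+1] below passes from the sup norm to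
     the Euclidean one. *)
  pose e := Num.min 1 (D / (2 * (enorm a + enorm b + 1))).
  have s0 : 0 < 2 * (enorm a + enorm b + 1) by lra.
  have e0 : 0 < e by rewrite lt_min ltr01 divr_gt0.
  have e1 : e <= 1 by rewrite ge_min lexx.
  have eD : e * (enorm a + enorm b + 1) <= D / 2.
    have : e <= D / (2 * (enorm a + enorm b + 1)) by rewrite ge_min lexx orbT.
    by rewrite ler_pdivlMr //; lra.
  have n0 : 0 < n.+1%:R :> R by [].
  have en0 : 0 < e / n.+1%:R by rewrite divr_gt0.
  have [r1 r10 yr1] := within_continuous_near cg by_ en0.
  have /nbhs_ballP[r2 /= r20 yr2] : nbhs y (grad phi @^-1` ball b (e / n.+1%:R)).
    by apply: ((c1 _ Uy).2); exact: nbhsx_ballx.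
  have /nbhs_ballP[r3 /= r30 yr3] : nbhs y U by apply: open_nbhs_nbhs.
  exists (Num.truncn ((enorm b + 1) / (D / 2))), (Num.min r1 (Num.min r2 r3)).
  split=> [|x M bx]; first by rewrite !lt_min r10 r20.
  rewrite !lt_min => /and3P[xr1 xr2 xr3] NM.
  have Ux : U x by apply: yr3; rewrite -ball_normE /= distrC.
  have ld' : local_defining Om x U phi by have [? ? ? ? ?] := ld; split.
  have {}xr1 := yr1 _ bx xr1.
  have {}xr2 : `|grad phi x - b| < e / n.+1%:R.
    have : (grad phi @^-1` ball b (e / n.+1%:R)) x by apply: yr2; rewrite -ball_normE /= distrC.
    by rewrite -ball_normE /= distrC.
  rewrite (nu_normal bx ld') dotpZr.
  pose u := gamma x - a; pose w := grad phi x - b.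
  have ue : enorm u <= e.
    by apply: le_trans (enorm_le_norm _) _; rewrite mulrC -ler_pdivlMr // ltW.
  have we : enorm w <= e.
    by apply: le_trans (enorm_le_norm _) _; rewrite mulrC -ler_pdivlMr // ltW.
  have gE : gamma x = a + u by rewrite addrC subrK.
  have pE : grad phi x = b + w by rewrite addrC subrK.
  have b'0 : 0 < enorm (grad phi x).
    by rewrite lt0r enorm_ge0 andbT; apply/eqP => /enorm0_eq0/eqP; apply/negP; exact: g0.
  have b'1 : enorm (grad phi x) <= enorm b + 1.
    by rewrite pE; apply: le_trans (ler_enormD _ _) _; lra.
  have dge : D / 2 <= dotp (gamma x) (grad phi x).
    rewrite gE pE dotpDl (dotpDr a b w) (dotpDr u b w) -/D.
    have := normr_dotp_le a w; rewrite ler_norml => /andP[h1 _].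
    have := normr_dotp_le u b; rewrite ler_norml => /andP[h2 _].
    have := normr_dotp_le u w; rewrite ler_norml => /andP[h3 _].
    have h4 : enorm a * enorm w <= enorm a * e by rewrite ler_wpM2l.
    have h5 : enorm u * enorm b <= e * enorm b by rewrite ler_wpM2r // ltW.
    have h6 : enorm u * enorm w <= e * 1.
      by rewrite ler_pM ?enorm_ge0 //; exact: le_trans e1.
    move: eD h1 h2 h3 h4 h5 h6; clear; rewrite mulr1 !mulrDr mulr1 [e * enorm a]mulrC; lra.
  rewrite mulrC ler_pdivlMr //.
  have D20 : 0 < D / 2 by lra.
  apply: le_trans dge; rewrite mulrC ler_pdivrMr // -ler_pdivrMl // mulrC.
  apply: (@le_trans _ _ ((enorm b + 1) / (D / 2))); first by rewrite ler_pM2r ?invr_gt0.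
  by apply/ltW/(lt_le_trans (truncnS_gt _)); rewrite ler_nat.
by exists N.+1%:R^-1; rewrite ?invr_gt0.
Qed.

(** On the boundary the velocity of the curve is tangential, so the scalar product of the sweeping
    equation with [nu] leaves [l (beta . nu) = v . nu <= |v|]. *)
Lemma SP_admissible (beta : 'rV[R]_n -> 'rV[R]_n) (rho : R) x eta v l :
  (forall y, boundary Om y -> rho <= dotp (beta y) (nu y)) ->
  SP Om beta 1 x eta v l ->
  {ae @lebesgue_measure R, forall s, 0 <= s -> admissible Om rho (eta s) (v s) (l s)}.
Proof.
(* Time 0 is discarded: tangency comes from a maximum over a two-sided neighbourhood in time. *)
move=> brho /SPE[_ _ Ome ae]; apply: ae_mono (ae_and ae (@ae_neq R 0)) => s [+ sn0] s0.
move=> /(_ s0)[de ev l0 lz]; have sp : 0 < s by rewrite lt_neqAle s0 andbT; apply/eqP => /esym.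
split => //; first exact: Ome.
have [Oe|nOe] := pselect (Om (eta s)); first by rewrite lz // mul0r enorm_ge0.
have be : boundary Om (eta s) by apply/boundaryE => //; split=> //; exact: Ome.
have [U [phi ld]] := Om_C1 be.
have tangent : dotp (derive1 eta s) (nu (eta s)) = 0.
  by rewrite (nu_normal be ld) dotpZr (dotp_velocity_grad Om_open sp Ome de be ld) mulr0.
have : l s * dotp (beta (eta s)) (nu (eta s)) = dotp (v s) (nu (eta s)).
  by rewrite -ev dotpDl dotpZl tangent add0r.
have := dotp_le_enorm (v s) (nu (eta s)); rewrite enorm_normal // mulr1.
have : l s * rho <= l s * dotp (beta (eta s)) (nu (eta s)) by rewrite ler_wpM2l ?brho.
lra.
Qed.

(** [theta < pi] alone gives [cos > -1] pointwise; by continuity and periodicity the minimum of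
    [cos theta] is attained, and [kap] is its opposite. *)
Lemma contact_angle_bound (theta : 'rV[R]_n -> R) : continuous theta ->
  periodic_on setT theta -> (forall y, pi / 2 <= theta y < pi) ->
  exists kap : R, [/\ 0 <= kap, kap < 1 & forall y, - kap <= cos (theta y) <= 0].
Proof.
move=> ct pt tr; have cneg y : cos (theta y) <= 0.
  have /andP[t1 t2] := tr y; have pi0 := pi_gt0 R.
  by rewrite -cos_pihalf leNgt ltr_cos ?in_itv /= -?leNgt //; lra.
pose A := [set x : 'rV[R]_n | `|x| <= 1].
have cA : compact A.
  apply: bounded_closed_compact.
    by exists 1; split; rewrite ?num_real // => M' MM' x /= xM; rewrite /A /= in xM; lra.
  rewrite (_ : A = (fun x : 'rV[R]_n => `|x|) @^-1` [set u | u <= 1]) //.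
  by apply: closed_comp => [x _|]; [exact: norm_continuous|exact: closed_le].
have [] := @EVT_min_rV R n (fun x => cos (theta x)) A _ cA.
- by exists 0; rewrite /A /= normr0.
- apply: continuous_subspaceT => x; apply: continuous_comp; first exact: ct.
  exact: continuous_cos.
move=> c cA' cmin; exists (- cos (theta c)); split; first by rewrite oppr_ge0.
  have /andP[t1 t2] := tr c; have pi0 := pi_gt0 R.
  by rewrite ltrNl -cospi ltr_cos ?in_itv //=; lra.
move=> y; rewrite opprK cneg andbT.
have iz := @int_vec_round _ _ (- y); rewrite -(pt y _ I iz); apply: cmin.
rewrite inE /A /=; have /unit_cube_norm := @unit_cube_round _ _ (- y).
by rewrite opprK addrC /=; lra.
Qed.

End uniform_constants.

(** * Measurability of the running cost *)

Section measurable_cost.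
Context {R : realType} {n : nat}.
Local Notation mu := (@lebesgue_measure R).

Definition rat_vec (k : nat) : 'rV[R]_n := map_mx ratr (odflt (0 : 'rV[rat]_n) (unpickle k)).

Lemma rat_vec_dense (p : 'rV[R]_n) (r : R) : 0 < r -> exists k, `|p - rat_vec k| < r.
Proof.
move=> r0; have r20 : 0 < r / 2 by lra.
have near_rat i : exists q : rat, `|p 0 i - ratr q| <= r / 2.
  have [q] : exists q : rat, ratr q \in `]p 0 i - r / 2, p 0 i + r / 2[.
    by apply: rat_in_itvoo; lra.
  by rewrite in_itv /= => pq; exists q; rewrite ler_norml; lra.
have [q qP] := choice near_rat; exists (pickle (\row_i q i)).
apply: (@le_lt_trans _ _ (r / 2)); last by lra.
by apply: norm_leP => [|i]; rewrite ?(ltW r20) // /rat_vec pickleK /= !mxE.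
Qed.

(** Reduces the supremum over [p] to a countable one, which preserves measurability in time;
    [sups _ 0] is the supremum of the whole sequence. *)
Lemma sup_rat_vec (f : 'rV[R]_n -> R) : continuous f -> has_ubound [set f p | p in setT] ->
  sup [set f p | p in setT] = sups (f \o rat_vec) 0.
Proof.
move=> cf fub; have -> : sups (f \o rat_vec) 0 = sup (range (f \o rat_vec)).
  rewrite /sups /sdrop; congr sup; apply/seteqP; split=> _ [k _ <-]; by exists k.
have rub : has_ubound (range (f \o rat_vec)).
  by case: fub => M fM; exists M => _ [k _ <-]; apply: fM; exists (rat_vec k).
apply/eqP; rewrite eq_le; apply/andP; split; last first.
  apply: ge_sup; first by exists (f (rat_vec 0)), 0%N.
  by move=> _ [k _ <-]; apply: ub_le_sup => //; exists (rat_vec k).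
apply: ge_sup; first by exists (f 0), 0.
move=> _ [p _ <-]; rewrite leNgt; apply/negP => lt.
have /nbhs_ballP[r /= r0 pr] : nbhs p (f @^-1` [set u | sup (range (f \o rat_vec)) < u]).
  by apply: cf; apply: open_nbhs_nbhs; split => //; exact: open_gt.
have [k pk] := rat_vec_dense p r0.
have : sup (range (f \o rat_vec)) < f (rat_vec k) by apply: pr; rewrite -ball_normE.
by rewrite ltNge => /negP; apply; apply: ub_le_sup => //; exists k.
Qed.

Lemma enorm_continuous : continuous (@enorm R n).
Proof.
move=> x A /nbhs_ballP[e /= e0 eA].
suff : nbhs x (@enorm R n @^-1` A) by [].
apply/nbhs_ballP; exists (e / n.+1%:R) => /=; first by rewrite divr_gt0.
move=> u; rewrite -ball_normE /= ltr_pdivlMr // => xu; apply: eA; rewrite -ball_normE /=.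
have xue : enorm (x - u) < e by apply: le_lt_trans xu; rewrite mulrC enorm_le_norm.
have := ler_enormD (x - u) u; have := ler_enormD (u - x) x.
rewrite !subrK -(enormN (u - x)) opprB => h1 h2.
by rewrite ltr_norml; lra.
Qed.

Definition half_line_ext (f : R -> R) (s : R) : R := if 0 <= s then f s else 0.

Lemma measurable_half_line_ext f : L1_loc f -> measurable_fun setT (half_line_ext f).
Proof.
move=> fL; pose D : set R := `[0, +oo[%classic.
have mf : measurable_fun D f.
  rewrite (_ : D = \bigcup_k `[0, k%:R]%classic).
    apply/measurable_fun_bigcup => // k.
    by have /integrableP[/measurable_EFinP] := fL k%:R (ler0n _ _).
  apply/seteqP; split=> s; rewrite /D /= in_itv /= ?andbT => s0.
    exists (Num.truncn s).+1 => //=; rewrite in_itv /= s0 ltW //.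
    exact: truncnS_gt.
  by case: s0 => k _ /=; rewrite in_itv /= => /andP[].
rewrite (_ : half_line_ext f = f \_ D); last first.
  by apply/funext => s; rewrite /patch /half_line_ext /D mem_setE in_itv /= andbT.
have mD : measurable D by exact: measurable_itv.
by apply/(measurable_restrictT _ mD).
Qed.

Variables (Om : set 'rV[R]_n) (H : 'rV[R]_n -> 'rV[R]_n -> R).
Variables (g h : 'rV[R]_n -> R) (K0 kap : R).
Hypothesis Om_open : open Om.
Hypothesis H_continuous : continuous (fun yp : 'rV[R]_n * 'rV[R]_n => H yp.1 yp.2).
Hypothesis H_growth : forall y p,
  enorm p ^+ 2 / 2 - K0 <= H y p <= enorm p ^+ 2 / 2 + K0.
Hypothesis h_continuous : continuous h.
Hypothesis h_itv : forall y, - kap <= h y <= 0.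
Hypothesis g_continuous : {within boundary Om, continuous g}.

(** [g] is controlled on the boundary only. The contact times form a closed set, on which [g \o eta]
    is continuous; elsewhere it is replaced by 0. *)
Lemma measurable_boundary_comp (eta : R -> 'rV[R]_n) : continuous eta ->
  measurable_fun setT ((g \o eta) \_ (eta @^-1` boundary Om)).
Proof.
move=> ce; have mE : measurable (eta @^-1` boundary Om).
  apply: closed_measurable; apply: closed_comp => [s _|]; first exact: ce.
  exact: closed_boundary.
apply/(measurable_restrictT _ mE); apply: subspace_continuous_measurable_fun => //.
apply/subspace_continuousP => s bs A /nbhs_ballP[e /= e0 eA].
have [r r0 yr] := within_continuous_near g_continuous bs e0.
have /nbhs_ballP[d /= d0 sd] : nbhs s (eta @^-1` ball (eta s) r).
  by apply: ce; exact: nbhsx_ballx.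
apply/nbhs_ballP; exists d => //= u su bu; apply: eA; rewrite -ball_normE /= distrC.
by apply: yr => //; have := sd u su; rewrite /= -ball_normE /= distrC.
Qed.

(** [F] is a countable supremum of measurable functions plus a term with [g] cut off outside the
    boundary; the cut-off changes nothing at the listed times, since [l] vanishes inside. *)
Lemma measurable_genL (eta v : R -> 'rV[R]_n) (l : R -> R) :
  AC_loc eta -> L1_loc_vec v -> L1_loc l ->
  exists2 F : R -> R, measurable_fun setT F &
    forall s, 0 <= s -> 0 <= l s -> closure Om (eta s) -> (Om (eta s) -> l s = 0) ->
      F s = genL H g h (eta s) (- v s) (- l s).
Proof.
move=> ac vL lL; pose eta0 (s : R) := eta (Num.max s 0).
have ce0 : continuous eta0 by exact: AC_loc_continuous.
pose v0 (s : R) : 'rV[R]_n := \row_i half_line_ext (fun s => v s 0 i) s.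
(* Made nonnegative at every time, so that the supremum over [p] is finite everywhere and not only
   almost everywhere. *)
pose l0 (s : R) := Num.max (half_line_ext l s) 0.
have ml : measurable_fun setT l0.
  by apply: measurable_maxr => //; exact: measurable_half_line_ext.
have l0_ge0 s : 0 <= l0 s by rewrite le_max lexx orbT.
pose f s p := dotp p (- v0 s) - H (eta0 s) p - h (eta0 s) * - l0 s * enorm p.
have fub s : has_ubound [set f s p | p in setT].
  by exact: (genL_has_sup H_growth h_itv (eta0 s) (v0 s) (l0_ge0 s)).2.
have fc s : continuous (f s).
  have c1 : continuous (fun p => dotp p (- v0 s)) by exact: dotp_continuous.
  have c2 : continuous (fun p => H (eta0 s) p).
    move=> p; apply: (@continuous_comp _ _ _ (fun p => (eta0 s, p)) (fun yp => H yp.1 yp.2)).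
      move=> A [[B C] [/= nB nC] BCA]; suff : nbhs p [set q | A (eta0 s, q)] by [].
      have /nbhs_ballP[r r0 pr] := nC; apply/nbhs_ballP; exists r => // q pq.
      by apply: BCA; split; [exact: nbhs_singleton|exact: pr].
    exact: H_continuous.
  have c3 : continuous (fun p : 'rV[R]_n => h (eta0 s) * - l0 s * enorm p).
    move=> p; apply: (@continuous_comp _ _ _ (@enorm R n) (fun u => h (eta0 s) * - l0 s * u)).
      exact: enorm_continuous.
    exact: mulrl_continuous.
  by move=> p; exact: (continuousB (continuousB (c1 p) (c2 p)) (c3 p)).
have mf p : measurable_fun setT (fun s => f s p).
  rewrite /f; apply: measurable_funB; first apply: measurable_funB.
  - rewrite /dotp; apply: measurable_sum => i.
    apply: measurable_funM => //.
    rewrite (_ : (fun s => (- v0 s) 0 i) = (fun s => - half_line_ext (fun s => v s 0 i) s)); last first.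
      by apply/funext => s; rewrite !mxE.
    by apply: measurable_funN; exact: measurable_half_line_ext.
  - apply: continuous_measurable_fun => s.
    apply: (@continuous_comp _ _ _ (fun s => (eta0 s, p)) (fun yp => H yp.1 yp.2)).
      exact: (cvg_pair (ce0 s) (cvg_cst _)).
    exact: H_continuous.
  - apply: measurable_funM => //; apply: measurable_funM; last exact: measurable_funN.
    apply: continuous_measurable_fun => s; apply: continuous_comp; first exact: ce0.
    exact: h_continuous.
pose F s := sups (f s \o rat_vec) 0 + ((g \o eta0) \_ (eta0 @^-1` boundary Om)) s * l0 s.
exists F.
  apply: measurable_funD.
    apply: measurable_fun_sups => //= s _.
    have [M fM] := fub s; exists M => _ [k _ <-]; apply: fM; by exists (rat_vec k).
  by apply: measurable_funM => //; exact: measurable_boundary_comp.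
move=> s s0 ls0 cs lz; rewrite /F -sup_rat_vec // /genL.
have etaE : eta0 s = eta s by rewrite /eta0 max_l.
have vE : v0 s = v s by apply/rowP => i; rewrite mxE /half_line_ext s0.
have lE : l0 s = l s by rewrite /l0 /half_line_ext s0 max_l.
rewrite /f vE lE etaE; congr (_ + _); rewrite mulrN opprK.
rewrite /patch; case: ifPn => /= [_|]; first by rewrite etaE.
rewrite notin_setE /= etaE => nb; have [/lz ->|nO] := pselect (Om (eta s)).
  by rewrite !mulr0.
by exfalso; apply: nb; apply/boundaryE.
Qed.

End measurable_cost.

(** * Gluing curves *)

Section reachability.
Context {R : realType} {n : nat}.
Local Notation mu := (@lebesgue_measure R).
Variables (Om : set 'rV[R]_n) (nu beta : 'rV[R]_n -> 'rV[R]_n).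
Variables (H : 'rV[R]_n -> 'rV[R]_n -> R) (g h : 'rV[R]_n -> R).
Variables (K0 kap rho G : R).
Implicit Types (x y z w : 'rV[R]_n) (eta v : R -> 'rV[R]_n) (l F : R -> R).
Hypothesis Om_open : open Om.
Hypothesis Om_periodic : [set x + z | x in Om & z in int_vec] = Om.
Hypothesis Om_C1 : C1_boundary Om.
Hypothesis nu_normal : outward_unit_normal Om nu.
Hypothesis beta_periodic : periodic_on (boundary Om) beta.
Hypothesis beta_nu : forall y, boundary Om y -> rho <= dotp (beta y) (nu y).
Hypothesis H_continuous : continuous (fun yp : 'rV[R]_n * 'rV[R]_n => H yp.1 yp.2).
Hypothesis H_periodic : forall p, periodic_on setT (H ^~ p).
Hypothesis H_growth : forall y p,
  enorm p ^+ 2 / 2 - K0 <= H y p <= enorm p ^+ 2 / 2 + K0.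
Hypothesis K0_gt0 : 0 < K0.
Hypothesis kap_ge0 : 0 <= kap.
Hypothesis kap_lt_rho : kap < rho.
Hypothesis h_itv : forall y, - kap <= h y <= 0.
Hypothesis h_continuous : continuous h.
Hypothesis h_periodic : periodic_on setT h.
Hypothesis g_continuous : {within boundary Om, continuous g}.
Hypothesis g_periodic : periodic_on (boundary Om) g.
Hypothesis g_bound : forall y, boundary Om y -> `|g y| <= G.
Hypothesis G_ge0 : 0 <= G.

Local Notation L := (genL H g h).
Local Notation C3 := (cost_shift K0 kap rho G).
Local Notation c0 := (coercivity kap rho).

Let C3_ge0 : 0 <= C3. Proof. exact: cost_shift_ge0. Qed.
Let c0_gt0 : 0 < c0. Proof. exact: coercivity_gt0. Qed.

(** A measurable, everywhere nonnegative version of the shifted running cost. Its integral may be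
    infinite. *)
Definition cost_density eta v l F :=
  [/\ measurable_fun setT F, (forall s, 0 <= F s) &
      {ae mu, forall s, 0 <= s -> L (eta s) (- v s) (- l s) + C3 = F s}].

Lemma SP_cost_density x eta v l : SP Om beta 1 x eta v l ->
  exists F, cost_density eta v l F.
Proof.
move=> sp; have /SPE[[ac vL lL] _ _ _] := sp.
have [F0 mF0 F0E] := measurable_genL Om_open H_continuous H_growth h_continuous h_itv
  g_continuous ac vL lL.
exists (fun s => Num.max (F0 s + C3) 0); split.
- by apply: measurable_maxr => //; apply: measurable_funD.
- by move=> s; rewrite le_max lexx orbT.
apply: ae_mono (SP_admissible Om_open Om_C1 nu_normal beta_nu sp) => s + s0.
move=> /(_ s0) ad; have [cs ls0 lz _] := ad; rewrite F0E // max_l //.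
have := genL_ge Om_open H_growth kap_ge0 kap_lt_rho h_itv g_bound G_ge0 ad.
by apply: le_trans; rewrite mulr_ge0 ?sqr_ge0 // ltW.
Qed.

(** The negative part of [F - C3] is at most [C3], so its integral [J] is finite and cancels even
    when the integral of [F] is infinite. *)
Lemma action_density eta v l F t : 0 <= t -> cost_density eta v l F ->
  (action L t eta v l + (C3 * t)%:E = \int[mu]_(s in `[0%R, t]) (F s)%:E)%E.
Proof.
move=> t0 [mF F0 FE]; pose f s := F s - C3.
have mf : measurable_fun `[0, t]%classic f.
  by apply: measurable_funB => //; exact: measurable_funS mF.
have mF' : measurable_fun `[0, t]%classic F by exact: measurable_funS mF.
have -> : action L t eta v l = (\int[mu]_(s in `[0%R, t]) (f s)%:E)%E.
  rewrite /action; apply: eq_integral_ae; apply: ae_mono FE => s FEs.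
  by rewrite /= in_itv /= => /andP[s0 _]; rewrite /f -(FEs s0) addrK.
have mt : mu `[0, t]%classic = t%:E.
  rewrite lebesgue_measure_itv /= lte_fin; case: ltP => [_|t0']; first by rewrite -EFinB subr0.
  by congr EFin; lra.
have intC : (\int[mu]_(s in `[0%R, t]) C3%:E = (C3 * t)%:E)%E.
  by rewrite integral_cst //= mt.
pose fp s := Num.max (f s) 0; pose fn s := Num.max (- f s) 0.
have mfp : measurable_fun `[0, t]%classic fp by apply: measurable_maxr.
have mfn : measurable_fun `[0, t]%classic fn.
  by apply: measurable_maxr => //; exact: measurable_funN.
have fp0 s : 0 <= fp s by rewrite le_max lexx orbT.
have fn0 s : 0 <= fn s by rewrite le_max lexx orbT.
pose J := (\int[mu]_(s in `[0%R, t]) (fn s)%:E)%E.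
have intf : (\int[mu]_(s in `[0%R, t]) (f s)%:E =
    \int[mu]_(s in `[0%R, t]) (fp s)%:E - J)%E.
  rewrite integralE /J; congr (_ - _)%E; apply: eq_integral => s _.
    by rewrite funeposE -EFin_max.
  by rewrite funenegE -EFinN -EFin_max.
have sumE : (\int[mu]_(s in `[0%R, t]) (fp s)%:E + (C3 * t)%:E =
    \int[mu]_(s in `[0%R, t]) (F s)%:E + J)%E.
  rewrite -intC /J -!ge0_integralD //=; do ?[by move=> *; rewrite lee_fin]; do ?[exact/measurable_EFinP].
  apply: eq_integral => s _; rewrite -!EFinD; congr EFin.
  by rewrite /fp /fn /f; case: (leP (F s - C3) 0); case: (leP (- (F s - C3)) 0); lra.
have fnfin : (J <= (C3 * t)%:E)%E.
  rewrite -intC /J; apply: ge0_le_integral => //=; do ?[by move=> *; rewrite lee_fin]; do ?[exact/measurable_EFinP].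
  by move=> s _; rewrite lee_fin /fn /f ge_max C3_ge0 andbT; have := F0 s; lra.
have fnge : (0 <= J)%E.
  by apply: integral_ge0 => s _; rewrite lee_fin.
rewrite intf; move: sumE fnfin fnge; case: (J) => // r sumE _ _.
by rewrite addeAC sumE addeK.
Qed.

(** The budget [c] bounds the action plus [C3 * t], which is nonnegative. *)
Definition reach x y (t c : R) := exists eta v l F,
  [/\ SP Om beta 1 x eta v l, eta t = y, cost_density eta v l F &
      (\int[mu]_(s in `[0%R, t]) (F s)%:E <= c%:E)%E].

Lemma reach_le x y t c c' : c <= c' -> reach x y t c -> reach x y t c'.
Proof.
move=> cc' [eta [v [l [F [? ? ? Fc]]]]]; exists eta, v, l, F; split => //.
by apply: le_trans Fc _; rewrite lee_fin.
Qed.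

Lemma metric_le_reach x y t c : 0 <= t -> reach x y t c ->
  (metric Om beta L t x y <= (c - C3 * t)%:E)%E.
Proof.
move=> t0 [eta [v [l [F [sp ey dF Fc]]]]].
apply: (@le_trans _ _ (action L t eta v l)).
  by apply: ereal_inf_lbound; exists eta, v, l.
by rewrite EFinB leeBrDr // (action_density t0 dF).
Qed.

Lemma reach_cat x y z a b c d : 0 <= a -> 0 <= b ->
  reach x y a c -> reach y z b d -> reach x z (a + b) (c + d).
Proof.
move=> a0 b0 [eta1 [v1 [l1 [F1 [sp1 e1 [mF1 F10 FE1] Fc]]]]].
move=> [eta2 [v2 [l2 [F2 [sp2 e2 [mF2 F20 FE2] Fd]]]]].
(* The glued curve gets a density of its own, which agrees almost everywhere with [F1] before [a]
   and with the delayed [F2] after it. *)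
have sp := SP_concat a0 sp1 e1 sp2; have [F dF] := SP_cost_density sp.
exists (concat a eta1 eta2), (concat a v1 v2), (concat a l1 l2), F; split => //.
  by rewrite /concat ltNge lerDl b0 /= addrAC subrr add0r.
have [mF F0 FE] := dF.
have mEF (D : set R) (f : R -> R) : measurable_fun setT f -> measurable_fun D (fun s => (f s)%:E).
  by move=> mf; apply/measurable_EFinP; exact: measurable_funS mf.
rewrite (_ : `[0, a + b]%classic = `[0, a[%classic `|` `[a, a + b]%classic); last first.
  apply/seteqP; split=> s /=; rewrite !in_itv /=.
    by case: (ltP s a) => sa /andP[? ?]; [left|right]; apply/andP; split.
  by move=> [] /andP[? ?]; apply/andP; split; lra.
rewrite ge0_integral_setU //=; last 3 first.
- exact: mEF.
- by move=> s _; rewrite lee_fin.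
- apply/disj_setPS => s [] /=; rewrite !in_itv /= => /andP[_ sa] /andP[? _].
  by move: sa; rewrite ltNge => /negP.
rewrite EFinD; apply: leeD.
  apply: le_trans Fc; apply: (@le_trans _ _ (\int[mu]_(s in `[0%R, a[) (F1 s)%:E)%E).
    rewrite le_eqVlt; apply/orP; left; apply/eqP; apply: eq_integral_ae.
    apply: ae_mono (ae_and FE FE1) => s [+ +]; rewrite /= in_itv /= => h1 h2 /andP[s0 sa].
    by rewrite -h1 // -h2 // /concat sa.
  apply: ge0_subset_integral => //=; first exact: mEF.
    by move=> s _; rewrite lee_fin.
  by apply: subset_itvl; rewrite bnd_simp.
apply: le_trans Fd; rewrite le_eqVlt; apply/orP; left; apply/eqP.
rewrite -(ge0_integral_affine (- a) ltr01) //=; last 2 first.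
- exact: mEF.
- by move=> s _; rewrite lee_fin.
rewrite mul1e (_ : _ @^-1` _ = `[a, a + b]%classic); last first.
  by apply/seteqP; split=> s /=; rewrite mul1r !in_itv /= => /andP[? ?]; apply/andP; split; lra.
apply: eq_integral_ae; apply: ae_mono (ae_and FE (ae_affine (- a) ltr01 FE2)) => s [+ +].
rewrite /= in_itv /= mul1r subr_ge0 => h1 h2 /andP[sa _].
by rewrite -h1 ?(le_trans a0) // -h2 // /concat ltNge sa.
Qed.

Lemma genL_translate y (v : 'rV[R]_n) (l : R) z : admissible Om rho y v l -> int_vec z ->
  L (y + z) (- v) (- l) = L y (- v) (- l).
Proof.
move=> [cy l0 lz _] iz; rewrite /genL; congr (sup _ - _).
  by apply: eq_imagel => p _; rewrite H_periodic // h_periodic.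
have [Oy|nOy] := pselect (Om y); first by rewrite lz // oppr0 !mulr0.
by rewrite g_periodic //; apply/boundaryE.
Qed.

Lemma reach_translate x y z t c : int_vec z -> reach x y t c ->
  reach (x + z) (y + z) t c.
Proof.
move=> iz [eta [v [l [F [sp ey [mF F0 FE] Fc]]]]].
exists (fun s => eta s + z), v, l, F; split => //; last first.
- split => //; apply: ae_mono (ae_and FE (SP_admissible Om_open Om_C1 nu_normal beta_nu sp)).
  by move=> s [h1 h2] s0; rewrite genL_translate ?h1 //; exact: h2.
- by rewrite ey.
- exact: SP_translate.
Qed.

Lemma reach_segment x w T : 0 <= T -> (forall s, 0 <= s <= T -> closure Om (x + s *: w)) ->
  reach x (x + T *: w) T (T * (enorm w ^+ 2 + 2 * C3)).
Proof.
move=> T0 seg; have sp := SP_segment beta T0 seg.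
have [F dF] := SP_cost_density sp.
exists (fun s : R => x + Num.min s T *: w), (concat T (fun=> w) (fun=> 0)), (fun=> 0), F; split; [exact: sp| |exact: dF|].
  by rewrite /= minxx.
(* One [C3] comes from the upper bound on the Lagrangian, the other from the shift in the
   density. *)
have [mF F0 FE] := dF; set K := enorm w ^+ 2 + 2 * C3.
have K_ge0 : 0 <= K by rewrite addr_ge0 ?sqr_ge0 // mulr_ge0.
have -> : (T * K)%:E = (\int[mu]_(s in `[0%R, T]) K%:E)%E.
  rewrite integral_cst //= lebesgue_measure_itv /= lte_fin; case: ltP => [_|T0'].
    by rewrite -EFinB subr0 -EFinM mulrC.
  by rewrite mule0 (_ : T = 0) ?mul0r //; lra.
apply: ae_ge0_le_integral => //=.
- by move=> s _; rewrite lee_fin.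
- by apply/measurable_EFinP; exact: measurable_funS mF.
have aeT := ae_and (ae_and FE (SP_admissible Om_open Om_C1 nu_normal beta_nu sp)) (@ae_neq R T).
apply: ae_mono aeT => s [[h1 h2] sT]; rewrite in_itv /= => /andP[s0 sleT].
have lsT : s < T by rewrite lt_neqAle sleT andbT; exact/eqP.
have := genL_le Om_open H_growth kap_ge0 kap_lt_rho h_itv g_bound G_ge0 (h2 s0).
rewrite lee_fin -(h1 s0) {2}/concat lsT /K; lra.
Qed.

(** [genL_speedup] integrated in time. The change of variable also gives a factor [1 / k] on the
    right, which is bounded by 1. *)
Lemma reach_speedup x y t c k : 0 <= t -> 1 <= k <= 2 -> reach x y t c ->
  reach x y (t / k) ((1 + (k - 1) * (4 / c0)) * c + (k - 1) * (2 * C3) * t).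
Proof.
move=> t0 k12 [eta [v [l [F [sp ey [mF F0 FE] Fc]]]]].
have k0 : 0 < k by lra.
have sp' := SP_speedup k0 sp; have [F' dF'] := SP_cost_density sp'.
exists (fun s => eta (k * s)), (fun s => k *: v (k * s)), (fun s => k * l (k * s)), F'.
split => //; first by rewrite mulrC divfK // gt_eqF.
have [mF' F'0 FE'] := dF'; set m := 1 + (k - 1) * (4 / c0); set b := (k - 1) * (2 * C3).
have k1 : 0 <= k - 1 by lra.
have m0 : 0 <= m by rewrite addr_ge0 // mulr_ge0 // divr_ge0 // ltW.
have b0 : 0 <= b by rewrite !mulr_ge0.
have tk0 : 0 <= t / k by rewrite divr_ge0 // ltW.
have mFk : measurable_fun setT (fun s => F (k * s)).
  have := @measurable_comp _ _ _ _ _ _ setT F setT (fun s : R => k * s) measurableT _ mF.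
  by apply=> //; apply: measurable_funM.
have mEF (D : set R) (f : R -> R) : measurable_fun setT f -> measurable_fun D (fun s => (f s)%:E).
  by move=> mf; apply/measurable_EFinP; exact: measurable_funS mf.
apply: (@le_trans _ _ (\int[mu]_(s in `[0%R, (t / k)%R]) (m * F (k * s) + b)%:E)%E).
  apply: ae_ge0_le_integral => //=.
  - by move=> s _; rewrite lee_fin.
  - exact: mEF.
  - by move=> s _; rewrite lee_fin addr_ge0 // mulr_ge0.
  - by apply: mEF; apply: measurable_funD => //; apply: measurable_funM.
  have aes := ae_and FE' (ae_affine 0 k0 (ae_and FE (SP_admissible Om_open Om_C1 nu_normal beta_nu sp))).
  apply: ae_mono aes => s [h1 +]; rewrite addr0 in_itv /= => -[h2 h3] /andP[s0 _].
  have ks0 : 0 <= k * s by rewrite mulr_ge0 // ltW.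
  rewrite lee_fin -(h1 s0) -(h2 ks0).
  exact: (genL_speedup Om_open H_growth kap_ge0 kap_lt_rho h_itv g_bound G_ge0 k12 (h3 ks0)).
under eq_integral do rewrite EFinD EFinM.
rewrite ge0_integralD //=; last 2 first.
- by move=> s _; rewrite -EFinM lee_fin mulr_ge0.
- by apply: (mEF _ (fun s => m * F (k * s))); apply: measurable_funM.
rewrite ge0_integralZl //=; last 2 first.
- exact: mEF.
- by move=> s _; rewrite lee_fin.
rewrite integral_cst //= lebesgue_measure_itv /= lte_fin [leRHS]EFinD; apply: leeD.
  rewrite EFinM; apply: lee_wpmul2l; first by rewrite lee_fin.
  apply: le_trans Fc.
  rewrite -(ge0_integral_affine 0 k0) //=; last 2 first.
  - exact: mEF.
  - by move=> s _; rewrite lee_fin.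
  rewrite (_ : _ @^-1` _ = `[0, t / k]%classic); last first.
    apply/seteqP; split=> s /=; rewrite addr0 !in_itv /= => /andP[h1 h2].
      by rewrite ler_pdivlMr // mulrC h2 andbT -(pmulr_rge0 _ k0).
    by rewrite mulr_ge0 ?(ltW k0) //= mulrC -ler_pdivlMr.
  under [in leRHS]eq_integral do rewrite addr0.
  rewrite -[leLHS]mul1e; apply: lee_wpmul2r; last by rewrite lee_fin; lra.
  by apply: integral_ge0 => s _; rewrite lee_fin.
case: ifP => _; last by rewrite mule0 lee_fin mulr_ge0.
rewrite -EFinB subr0 -EFinM lee_fin ler_wpM2l // ler_pdivrMr //; nra.
Qed.

(** Each of the [N.+1] edges receives the time [T / N.+1], so the Euclidean speed is at most
    [n.+1 * c * N.+1 / T]. *)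
Lemma reach_linked c N x y (T : R) : 0 <= c -> 0 < T -> closure Om x ->
  linked Om c N.+1 x y ->
  reach x y T (T * ((n.+1%:R * (c * N.+1%:R) / T) ^+ 2 + 2 * C3)).
Proof.
move=> c_ge0 T0; pose tau := T / N.+1%:R.
have tau0 : 0 < tau by rewrite divr_gt0.
have -> : n.+1%:R * (c * N.+1%:R) / T = n.+1%:R * c / tau.
  by rewrite /tau; field; rewrite nat1r !gt_eqF.
have TE : T = N.+1%:R * tau by rewrite mulrC divfK // gt_eqF.
set K := _ + _; rewrite TE -mulrA.
have K_ge0 : 0 <= K by rewrite addr_ge0 ?sqr_ge0 // mulr_ge0.
have step u w : segment_in Om u w -> `|w - u| <= c -> reach u w tau (tau * K).
  move=> uw uwc; have wE : w = u + tau *: (tau^-1 *: (w - u)).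
    by rewrite scalerA divff ?gt_eqF // scale1r addrC subrK.
  rewrite [in reach _ w]wE; apply: reach_le (reach_segment (ltW tau0) _).
    rewrite ler_wpM2l ?(ltW tau0) // lerD2r ler_sqr ?nnegrE ?enorm_ge0 //; last first.
      by rewrite !mulr_ge0 ?invr_ge0 ?(ltW tau0).
    rewrite enormZ ger0_norm ?invr_ge0 ?(ltW tau0) // mulrC ler_wpM2r ?invr_ge0 ?(ltW tau0) //.
    by apply: le_trans (enorm_le_norm _) _; rewrite ler_wpM2l.
  move=> s /andP[s0 st]; rewrite scalerA; apply: uw.
  by rewrite divr_ge0 ?(ltW tau0) //= ler_pdivrMr // mul1r.
clear TE; clearbody tau; elim: N x => [|N IH] x cx.
  by move=> [z [xz zc /= <-]]; rewrite !mul1r; exact: step.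
move=> [z [xz zc zy]]; rewrite -natr1 !mulrDl !mul1r addrC [X in reach _ _ _ X]addrC.
have cz : closure Om z by have := xz 1; rewrite scale1r addrC subrK lexx ler01; exact.
by apply: reach_cat (step _ _ xz zc) (IH z cz zy); rewrite ?mulr_ge0 ?(ltW tau0).
Qed.

Lemma reach_iter (b : nat -> 'rV[R]_n) (tau c : R) m : 0 <= tau ->
  (forall j, reach (b j) (b j.+1) tau c) ->
  reach (b 0) (b m.+1) (m.+1%:R * tau) (m.+1%:R * c).
Proof.
move=> tau0 bb; elim: m => [|m IH]; first by rewrite !mul1r.
by rewrite -natr1 !mulrDl !mul1r; apply: reach_cat IH (bb _); rewrite ?mulr_ge0.
Qed.

Lemma ext_metric_le_reach x y t c : 0 <= t -> forall x' y', boundary Om x' -> boundary Om y' ->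
  unit_cube (x' - x) -> unit_cube (y' - y) -> reach x' y' t c ->
  (ext_metric Om beta L t x y <= (c - C3 * t)%:E)%E.
Proof.
move=> t0 x' y' bx by_ xx yy r; apply: le_trans (metric_le_reach t0 r).
by apply: ereal_inf_lbound; exists x', y'.
Qed.

(** Isolating [a] turns the claim into a lower bound for an infimum, to be checked on each
    competitor, whose action may be infinite. *)
Lemma le_doubleP (x a : \bar R) (C : R) :
  (x <= 2%:E * a + C%:E)%E <-> (2^-1%:E * (x - C%:E) <= a)%E.
Proof.
have h0 : (0 < 2^-1 :> R) by rewrite invr_gt0.
have h2 : (0 < 2 :> R) by [].
case: x => [x||]; case: a => [a||];
  rewrite ?gt0_muley ?gt0_muleNy ?lte_fin //= ?gt0_muley ?gt0_muleNy ?lte_fin //=.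
- by rewrite !lee_fin; split; lra.
- by rewrite addye // !leey.
- by rewrite !leNye.
Qed.

(** * The doubling inequality *)

Section doubling.
Variable M0 : R.
Hypothesis M0_gt0 : 0 < M0.
Hypothesis Om_connected : connected Om.
Hypothesis Om_bdry : boundary Om !=set0.

Lemma ext_metric_doubling : exists2 C : R, 0 <= C &
  forall (t : R) (y : 'rV[R]_n), 1 <= t -> enorm y <= M0 * t ->
    (ext_metric Om beta L (2 * t)%R 0%R (2 *: y)%R <=
      2%:E * ext_metric Om beta L t 0%R y + C%:E)%E.
Proof.
have [N0 chN] := boundary_chained Om_open Om_connected Om_C1 Om_periodic Om_bdry.
have bc x : boundary Om x -> closure Om x by move=> /(boundaryE _ Om_open)[].
pose N := N0.+1.
pose D : R := n.+1%:R * (N%:R * N%:R).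
have D_ge0 : 0 <= D by rewrite !mulr_ge0.
have connect x y (T : R) : boundary Om x -> boundary Om y -> `|x - y| <= 3 -> 0 < T ->
    reach x y T (T * ((D / T) ^+ 2 + 2 * C3)).
  move=> bx by_ xy T0; apply: reach_linked => //; first exact: bc.
  exact: (chained_le (leqnSn N0) (bc _ bx) (chN _ _ bx by_ xy)).
have [x0 bx0] := Om_bdry.
(* A boundary point in [w + Y]: the integer translate of a fixed boundary point that is nearest to
   [w]. *)
pose b w := x0 + round_vec (w - x0).
have bb w : boundary Om (b w) by apply: boundary_add => //; exact: int_vec_round.
have bY w : unit_cube (b w - w).
  have := unit_cube_round (w - x0); rewrite (_ : _ - (w - x0) = b w - w) //.
  by apply/rowP => i; rewrite !mxE; ring.
have bdist w w' : `|w - w'| <= 2 -> `|b w - b w'| <= 3.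
  move=> ww; rewrite (_ : b w - b w' = (b w - w) - (b w' - w') + (w - w')); last first.
    by apply/rowP => i; rewrite !mxE; ring.
  apply: le_trans (ler_normD _ _) _; have := ler_normB (b w - w) (b w' - w').
  by have := unit_cube_norm (bY w); have := unit_cube_norm (bY w'); lra.
(* Cost per unit time of the polygonal competitor. Its stages last
   [tau = 2 t / m.+1 >= 2 / (M0 + 1)] because [m.+1 <= (M0 + 1) t], so
   [D / tau <= D (M0 + 1) / 2]. *)
pose Q := (D * (M0 + 1) / 2) ^+ 2 + 2 * C3.
have Q_ge0 : 0 <= Q by rewrite addr_ge0 ?sqr_ge0 // mulr_ge0.
have crude (t : R) y : 1 <= t -> enorm y <= M0 * t ->
    reach (b 0) (b (2 *: y)) (2 * t) (2 * t * Q).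
  (* With [m.+1 > M0 t] stages, consecutive targets on the segment from 0 to [2 y] are at most 2
     apart, as [bdist] requires. *)
  move=> t1 yt; pose m := Num.truncn (M0 * t).
  have t0 : 0 < t by exact: lt_le_trans t1.
  have M0t : 0 <= M0 * t by rewrite mulr_ge0 // ltW.
  have mle : m%:R <= M0 * t by rewrite truncn_le.
  have mlt : M0 * t < m.+1%:R by rewrite truncnS_gt.
  have m0 : 0 < m.+1%:R :> R by [].
  pose tau := 2 * t / m.+1%:R.
  have tau0 : 0 < tau by rewrite divr_gt0 //; lra.
  pose c j : 'rV[R]_n := b ((j%:R / m.+1%:R) *: (2 *: y)).
  have -> : b 0 = c 0 by rewrite /c mul0r scale0r.
  have -> : b (2 *: y) = c m.+1 by rewrite /c divff ?gt_eqF // scale1r.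
  have -> : 2 * t = m.+1%:R * tau by rewrite [RHS]mulrC divfK // gt_eqF.
  rewrite -mulrA; apply: reach_iter => [|j]; first exact: ltW.
  apply: reach_le (connect _ _ tau (bb _) (bb _) _ tau0).
    rewrite ler_wpM2l ?(ltW tau0) // lerD2r ler_sqr ?nnegrE; last 2 first.
    - by rewrite divr_ge0 // ltW.
    - by rewrite divr_ge0 // mulr_ge0 // addr_ge0 // ltW.
    have -> : D * (M0 + 1) / 2 = D * ((M0 + 1) / 2) by rewrite mulrA.
    rewrite ler_wpM2l // /tau invf_div ler_pdivrMr ?mulr_gt0 //.
    have : m.+1%:R <= (M0 + 1) * t by rewrite -natr1 mulrDl mul1r lerD.
    by move=> h1; apply: le_trans h1 _; rewrite mulrA divfK.
  apply: bdist; rewrite -[j.+1%:R]natr1.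
  have -> : (j%:R / m.+1%:R) *: (2 *: y) - ((j%:R + 1) / m.+1%:R) *: (2 *: y) =
      - (2 / m.+1%:R) *: y by apply/rowP => i; rewrite !mxE; ring.
  rewrite normrZ normrN ger0_norm ?divr_ge0 // mulrAC ler_pdivrMr // ler_pM2l //.
  by apply: le_trans (norm_le_enorm _) (le_trans yt (ltW mlt)).
pose A := 4 / c0; pose B := 2 * C3.
have A_ge0 : 0 <= A by rewrite divr_ge0 // ltW.
have B_ge0 : 0 <= B by rewrite mulr_ge0.
pose K1 := 1 * ((D / 1) ^+ 2 + 2 * C3).
have K1_ge0 : 0 <= K1 by rewrite mulr_ge0 // addr_ge0 ?sqr_ge0 // mulr_ge0.
(* [A * Q + B] is the price of speeding up one copy, [K1] that of the connecting path run in time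
   1. *)
exists (2 * (A * Q + B) + K1); first by rewrite addr_ge0 // mulr_ge0 // addr_ge0 // mulr_ge0.
move=> t y t1 yt; have t0 : 0 <= t by lra.
have t20 : 0 <= 2 * t by lra.
apply/le_doubleP/ereal_infP => _ [x' [y' [bx' by' xY yY ->]]].
apply/ereal_infP => _ [eta [v [l [sp ey ->]]]]; apply/le_doubleP.
have [F dF] := SP_cost_density sp; have aE := action_density t0 dF.
have F_ge0 : (0 <= \int[mu]_(s in `[0%R, t]) (F s)%:E)%E.
  by apply: integral_ge0 => s _; rewrite lee_fin; have [_ + _] := dF.
(* At [+oo] there is nothing to prove, and [-oo] is excluded because the density is nonnegative. *)
move: aE; case E : (action L t eta v l) => [a||] aE; last 2 first.
- by rewrite gt0_muley ?lte_fin //= leey.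
- by move: F_ge0; rewrite -aE.
pose c := a + C3 * t.
have cF : (\int[mu]_(s in `[0%R, t]) (F s)%:E)%E = c%:E by rewrite -aE.
have c_ge0 : 0 <= c by move: F_ge0; rewrite cF lee_fin.
rewrite -EFinM -EFinD.
(* Both sides carry the shift [2 C3 t], so the polygonal competitor suffices as soon as
   [2 t Q <= 2 c]. *)
have [Qc|cQ] := leP (Q * t) c.
  apply: le_trans (ext_metric_le_reach t20 (bb 0) (bb (2 *: y)) (bY _) (bY _) (crude t y t1 yt)) _.
  have : 0 <= A * Q by rewrite mulr_ge0.
  by rewrite lee_fin /c in Qc *; move=> *; lra.
have r : reach x' y' t c by exists eta, v, l, F; split => //; rewrite cF.
(* For [t >= 1] this gives [k <= 2] and [(k - 1) t = t / (2 t - 1) <= 1]. *)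
pose k := t / (t - 2^-1).
have th0 : 0 < t - 2^-1 by lra.
have k12 : 1 <= k <= 2 by rewrite ler_pdivlMr // ler_pdivrMr //; lra.
have kt : (k - 1) * t <= 1.
  have -> : (k - 1) * t = 2^-1 * t / (t - 2^-1) by rewrite /k; field; lra.
  by rewrite ler_pdivrMr //; lra.
have tk : t / k = t - 2^-1 by rewrite /k; field; lra.
(* Since [c < Q t], the increase [(k - 1) (A c + B t)] is at most [(k - 1) t (A Q + B)]. *)
have r1 : reach x' y' (t - 2^-1) (c + (A * Q + B)).
  have := reach_speedup t0 k12 r; rewrite tk; apply: reach_le; rewrite -/A -/B.
  have k1 : 0 <= k - 1 by lra.
  have h1 : (k - 1) * A * c <= (k - 1) * A * (Q * t) by apply: ler_wpM2l (ltW cQ); rewrite mulr_ge0.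
  have h2 : (k - 1) * t * (A * Q + B) <= 1 * (A * Q + B).
    by rewrite ler_wpM2r // addr_ge0 // mulr_ge0.
  by lra.
pose z := round_vec (2 *: y - y'); have iz : int_vec z := int_vec_round _.
have zY : unit_cube (z - (2 *: y - y')) := unit_cube_round _.
have bxz : boundary Om (x' + z) by exact: boundary_add.
have byz : boundary Om (y' + z) by exact: boundary_add.
have close : `|y' - (x' + z)| <= 3.
  (* Four vectors of the unit cube up to sign, so the distance is at most 2. *)
  rewrite (_ : _ - _ = (y' - y) + (y' - y) - (x' - 0) - (z - (2 *: y - y'))); last first.
    by apply/rowP => i; rewrite !mxE; ring.
  apply: le_trans (ler_normB _ _) _; have h1 := unit_cube_norm zY.
  have h2 := ler_normB ((y' - y) + (y' - y)) (x' - 0); have h3 := unit_cube_norm xY.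
  have h4 := ler_normD (y' - y) (y' - y); have h5 := unit_cube_norm yY.
  by move: h1 h2 h3 h4 h5; lra.
have r2 : reach x' (y' + z) (2 * t) (2 * c + 2 * (A * Q + B) + K1).
  have := reach_cat (ltW th0) (_ : 0 <= 1 + (t - 2^-1)) r1
    (reach_cat ler01 (ltW th0) (connect _ _ 1 by' bxz close ltr01) (reach_translate iz r1)).
  rewrite (_ : t - 2^-1 + (1 + (t - 2^-1)) = 2 * t); last by lra.
  by move=> /(_ ltac:(lra)); apply: reach_le; rewrite -/K1; lra.
have yz : unit_cube (y' + z - 2 *: y).
  by rewrite (_ : _ - _ = z - (2 *: y - y')) //; apply/rowP => i; rewrite !mxE; ring.
apply: le_trans (ext_metric_le_reach t20 bx' byz xY yz r2) _.
by rewrite lee_fin /c; lra.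
Qed.

End doubling.

End reachability.

(** * Application to the two problems *)

Lemma lagrangianN_genL {R : realType} {n : nat} (H : 'rV[R]_n -> 'rV[R]_n -> R) g :
  lagrangianN H g = genL H g (fun=> 0).
Proof.
apply/funext => y; apply/funext => q; apply/funext => l.
rewrite /lagrangianN /genL; congr (sup _ - _).
by apply: eq_imagel => p _; rewrite !mul0r subr0.
Qed.

Lemma lagrangianC_genL {R : realType} {n : nat} (H : 'rV[R]_n -> 'rV[R]_n -> R) h :
  lagrangianC H h = genL H (fun=> 0) h.
Proof.
by apply/funext => y; apply/funext => q; apply/funext => l; rewrite /genL mul0r subr0.
Qed.

Theorem lemma4p6 (R : realType) (n : nat) (Om : set 'rV[R]_n)
    (nu gamma : 'rV[R]_n -> 'rV[R]_n) (H : 'rV[R]_n -> 'rV[R]_n -> R)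
    (K0 : R) (u0 g theta : 'rV[R]_n -> R) (M0 : R) (b : problem)
    (n_ge2 : (2 <= n)%N)
    (Om_open : open Om) (Om_connected : connected Om)
    (Om_bdry : boundary Om !=set0) (Om_C1 : C1_boundary Om)
    (Om_periodic : [set x + z | x in Om & z in int_vec] = Om)
    (nu_normal : outward_unit_normal Om nu)
    (H_continuous : continuous (fun yp : 'rV[R]_n * 'rV[R]_n => H yp.1 yp.2))
    (H_periodic : forall p, periodic_on setT (H ^~ p))
    (H_convex : forall y, convex_function setT (H y))
    (K0_gt0 : 0 < K0)
    (H_growth : forall y p,
      enorm p ^+ 2 / 2 - K0 <= H y p <= enorm p ^+ 2 / 2 + K0)
    (u0_bounded : bounded_fun u0) (u0_unif_continuous : unif_continuous u0)
    (u0_lipschitz : exists k : R, k.-lipschitz u0)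
    (gamma_continuous : {within boundary Om, continuous gamma})
    (gamma_periodic : periodic_on (boundary Om) gamma)
    (gamma_nu : forall y, boundary Om y -> 0 < dotp (gamma y) (nu y))
    (g_continuous : {within boundary Om, continuous g})
    (g_periodic : periodic_on (boundary Om) g)
    (theta_range : forall y, pi / 2 <= theta y < pi)
    (theta_continuous : continuous theta)
    (theta_periodic : periodic_on setT theta)
    (M0_gt0 : 0 < M0)
    (M0_minimizers : bounded_minimizers Om (direction b gamma nu)
       (lagrangian b H g (fun y => cos (theta y))) u0 M0) :
  let mstar := ext_metric Om (direction b gamma nu)
                 (lagrangian b H g (fun y => cos (theta y))) in
  exists2 C : R, 0 <= C &
    forall (t : R) (y : 'rV[R]_n), 1 <= t -> enorm y <= M0 * t ->
      (mstar (2 * t)%R 0%R (2 *: y)%R <= 2%:E * mstar t 0%R y + C%:E)%E.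
Proof.
case: b {M0_minimizers} => mstar; rewrite /mstar /direction /lagrangian.
  (* Neumann: [h = 0] and [kap = 0], while [rho] comes from the obliqueness of [gamma]. *)
  have [rho rho0 grho] := oblique_bound Om_open Om_periodic Om_C1 nu_normal
    gamma_continuous gamma_periodic gamma_nu.
  have [G G0 gG] := boundary_bounded Om_open Om_periodic g_continuous g_periodic.
  rewrite lagrangianN_genL.
  apply: (ext_metric_doubling Om_open Om_periodic Om_C1 nu_normal gamma_periodic grho
    H_continuous H_periodic H_growth K0_gt0 (lexx 0) rho0 _ _ _ g_continuous
    g_periodic gG G0 M0_gt0 Om_connected Om_bdry) => //.
  - by move=> y; rewrite oppr0 lexx.
  - by move=> y; exact: cst_continuous.
(* Capillary: [beta = nu] is a unit vector, so [rho = 1], and [kap < 1] comes from the contact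
   angle; [g = 0] gives [G = 0]. *)
have [kap [kap0 kap1 hkap]] := contact_angle_bound theta_continuous theta_periodic theta_range.
rewrite lagrangianC_genL.
apply: (ext_metric_doubling (rho := 1) (kap := kap) (G := 0) Om_open Om_periodic Om_C1 nu_normal
  (normal_periodic Om_open Om_periodic Om_C1 nu_normal) _
  H_continuous H_periodic H_growth K0_gt0 kap0 kap1 hkap _ _ _
  _ _ (lexx 0) M0_gt0 Om_connected Om_bdry).
- by move=> y /(enorm_normal Om_C1 nu_normal) nu1; rewrite -sqr_enorm nu1 expr1n.
- move=> y; apply: continuous_comp; first exact: theta_continuous.
  exact: continuous_cos.
- by move=> y z _ iz; rewrite theta_periodic.
- by apply: continuous_subspaceT => y; exact: cst_continuous.
- by [].
- by move=> y _; rewrite normr0.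
Qed.
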